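(* Let $H$, $J$, $A$ and the Dirac operator $D=D_0+D_1+D_R$ be as in the context, and suppose $\delta_{12}=\delta_{13}=\delta_{14}=\beta_{13}=\beta_{14}=\alpha_{13}=\alpha_{14}=0$. Then the Hodge property $\mathcal{C}\ell_D(A)'=\mathcal{C}\ell_D(A)^\circ$ holds if and only if $\delta_{21}\neq 0$ and none of the three vectors $(\alpha_{23},\alpha_{24})$, $(\beta_{23},\beta_{24})$, $(\delta_{22},\delta_{23},\delta_{24})$ is zero.
   Context: Let $H=M_4(\mathbb{C})\oplus M_4(\mathbb{C})$, with elements written as pairs $(v,w)$ and inner product $\langle (v,w),(v',w')\rangle=\mathrm{Tr}(v^*v')+\mathrm{Tr}(w^*w')$. Let $J$ be the antilinear isometry $J(v,w)=(w^*,v^* )$. Identify $\mathrm{End}_{\mathbb{C}}(H)$ with $M_4(\mathbb{C})\otimes M_2(\mathbb{C})\otimes M_4(\mathbb{C})$ via $\big(x\otimes\begin{bmatrix}a&b\\c&d\end{bmatrix}\otimes y\big)(v,w)=\big(x(av+bw)y^t,\ x(cv+dw)y^t\big)$. Here $e_{ij}$ denotes the matrix unit with $1$ in position $(i,j)$ (size clear from context) and $1$ the identity matrix. Let $A\cong\mathbb{C}\oplus\mathbb{H}\oplus M_3(\mathbb{C})$ be the real $*$-algebra of operators $\mathrm{diag}(\lambda,\bar\lambda,q)\otimes e_{11}\otimes 1+\mathrm{diag}(\lambda,m)\otimes e_{22}\otimes 1$, where $\lambda\in\mathbb{C}$, $q$ is a quaternion viewed as a $2\times 2$ complex matrix $\begin{bmatrix}z&w\\-\bar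 w&\bar z\end{bmatrix}$, $m\in M_3(\mathbb{C})$, and $\mathrm{diag}$ denotes block-diagonal $4\times4$ matrices. Fix complex parameters $\alpha_{ij},\beta_{ij}$ ($i\in\{1,2\}$, $j\in\{3,4\}$), $\delta_{12},\delta_{13},\delta_{14},\delta_{21},\delta_{22},\delta_{23},\delta_{24}$ and $\Upsilon_R$. Put $\alpha=\begin{bmatrix}\alpha_{13}&\alpha_{14}\\ \alpha_{23}&\alpha_{24}\end{bmatrix}$, $\beta=\begin{bmatrix}\beta_{13}&\beta_{14}\\ \beta_{23}&\beta_{24}\end{bmatrix}$, $X_\alpha=\begin{bmatrix}0&\alpha\\ \alpha^*&0\end{bmatrix}\in M_4(\mathbb{C})$ (in $2\times2$ blocks), $X_\beta$ likewise, and $Y\in M_4(\mathbb{C})$ the matrix with first row $(0,\delta_{12},\delta_{13},\delta_{14})$, second row $(\delta_{21},\delta_{22},\delta_{23},\delta_{24})$ and zero third and fourth rows. Define $D_0=X_\alpha\otimes e_{11}\otimes e_{11}+X_\beta\otimes e_{11}\otimes(1-e_{11})+Y\otimes e_{12}\otimes e_{11}+Y^*\otimes e_{21}\otimes e_{11}$, $D_1=JD_0J^{-1}$, $D_R=e_{11}\otimes(\Upsilon_R e_{21}+\overline{\Upsilon}_R e_{12})\otimes e_{11}$, and $D=D_0+D_1+D_R$. For $\xi\in\mathrm{End}_{\mathbb{C}}(H)$ set $\xi^\circ=J\xi^*J^{-1}$, and for a subset $S$ set $S^\circ=\{\xi^\circ:\xi\in S\}$ and $S'=\{\xi\in\mathrm{End}_{\mathbb{C}}(H):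 [\xi,\eta]=0\ \forall\eta\in S\}$. $\mathcal{C}\ell_D(A)$ is the complex $*$-subalgebra of $\mathrm{End}_{\mathbb{C}}(H)$ generated by $A$ and the operators $a[D,b]$, $a,b\in A$. The Hodge property means $\mathcal{C}\ell_D(A)'=\mathcal{C}\ell_D(A)^\circ$. *)

(* Defs.v *)
(* Complex numbers are modelled as R[i] (= complex R from
   mathcomp-real-closed) for an arbitrary R : realType (a complete archimedean
   ordered field, i.e. a model of the reals), so R[i] is a model of C. *)
From mathcomp Require Import all_boot all_algebra.
From mathcomp Require Import reals complex.
Set Implicit Arguments. Unset Strict Implicit. Unset Printing Implicit Defensive.
Import GRing.Theory Num.Theory.
Local Open Scope ring_scope.

Section HodgeDefs.
Variable R : realType.
Local Notation C := R[i].

Definition H := ('M[C]_4 * 'M[C]_4)%type.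
Definition op := H -> H.

Definition is_linear (f : op) : Prop :=
  forall (c : C) (x y : H), f (c *: x + y) = c *: f x + f y.

Definition mxl (m n : nat) (ls : seq (seq C)) : 'M[C]_(m, n) :=
  \matrix_(i < m, j < n) nth 0 (nth [::] ls i) j.

Definition cmx (m n : nat) (A : 'M[C]_(m, n)) : 'M[C]_(n, m) :=
  (map_mx (@conjc R) A)^T.

Definition inner (x y : H) : C :=
  \tr (cmx x.1 *m y.1) + \tr (cmx x.2 *m y.2).

(* the antilinear isometry J(v,w) = (w^* , v^* ); note J o J = id, so J^{-1} = J *)
Definition J (x : H) : H := (cmx x.2, cmx x.1).

(* the identification M_4 (x) M_2 (x) M_4 -> End_C(H):
   (x (x) [a b; c d] (x) y)(v,w) = (x(av+bw)y^t, x(cv+dw)y^t) *)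
Definition tens (x : 'M[C]_4) (m : 'M[C]_2) (y : 'M[C]_4) : op :=
  fun vw => (x *m (m ord0 ord0 *: vw.1 + m ord0 ord_max *: vw.2) *m y^T,
             x *m (m ord_max ord0 *: vw.1 + m ord_max ord_max *: vw.2) *m y^T).

Definition opadd (f g : op) : op := fun x => f x + g x.

Definition e4_11 : 'M[C]_4 := delta_mx ord0 ord0.
Definition e2 (i j : 'I_2) : 'M[C]_2 := delta_mx i j.
Definition i1 : 'I_2 := ord0.
Definition i2 : 'I_2 := ord_max.

Definition quat (z w : C) : 'M[C]_2 :=
  mxl 2 2 [:: [:: z; w]; [:: - conjc w; conjc z]].

Definition diag_lq (lam z w : C) : 'M[C]_4 :=
  block_mx (block_mx (lam%:M : 'M[C]_1) 0 0 ((conjc lam)%:M : 'M[C]_1)) 0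
           0 (quat z w) : 'M[C]_(2 + 2).
Definition diag_lm (lam : C) (m : 'M[C]_3) : 'M[C]_4 :=
  block_mx (lam%:M : 'M[C]_1) 0 0 m : 'M[C]_(1 + 3).

(* elements of the real *-algebra A = C (+) H (+) M_3(C) *)
Definition Aop (lam z w : C) (m : 'M[C]_3) : op :=
  opadd (tens (diag_lq lam z w) (e2 i1 i1) 1%:M)
        (tens (diag_lm lam m) (e2 i2 i2) 1%:M).

Definition inA (a : op) : Prop :=
  exists (lam z w : C) (m : 'M[C]_3), a = Aop lam z w m.

Definition Xmx (a : 'M[C]_2) : 'M[C]_4 := block_mx 0 a (cmx a) 0 : 'M[C]_(2 + 2).

Definition Ymx (d12 d13 d14 d21 d22 d23 d24 : C) : 'M[C]_4 :=
  mxl 4 4 [:: [:: 0; d12; d13; d14]; [:: d21; d22; d23; d24]].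

Definition D0 (a13 a14 a23 a24 b13 b14 b23 b24
               d12 d13 d14 d21 d22 d23 d24 : C) : op :=
  let al := mxl 2 2 [:: [:: a13; a14]; [:: a23; a24]] in
  let be := mxl 2 2 [:: [:: b13; b14]; [:: b23; b24]] in
  let Y := Ymx d12 d13 d14 d21 d22 d23 d24 in
  opadd (opadd (tens (Xmx al) (e2 i1 i1) e4_11)
               (tens (Xmx be) (e2 i1 i1) (1%:M - e4_11)))
        (opadd (tens Y (e2 i1 i2) e4_11)
               (tens (cmx Y) (e2 i2 i1) e4_11)).

Definition D1 (D0' : op) : op := fun x => J (D0' (J x)).

Definition DR (U : C) : op :=
  tens e4_11 (U *: e2 i2 i1 + conjc U *: e2 i1 i2) e4_11.

Definition Dirac (a13 a14 a23 a24 b13 b14 b23 b24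
                  d12 d13 d14 d21 d22 d23 d24 U : C) : op :=
  let d0 := D0 a13 a14 a23 a24 b13 b14 b23 b24 d12 d13 d14 d21 d22 d23 d24 in
  opadd (opadd d0 (D1 d0)) (DR U).

Definition is_adjoint (eta xi : op) : Prop :=
  forall x y : H, inner (eta x) y = inner x (xi y).

(* complex *-subalgebra of End_C(H) generated by a set G of operators
   (smallest set containing G, closed under sums, complex scalar multiples,
   products (composition) and adjoints; operators are identified extensionally) *)
Inductive star_alg (G : op -> Prop) : op -> Prop :=
| sa_gen f : G f -> star_alg G f
| sa_add f g : star_alg G f -> star_alg G g -> star_alg G (opadd f g)
| sa_scale (c : C) f : star_alg G f -> star_alg G (fun x => c *: f x)
| sa_mul f g : star_alg G f -> star_alg G g -> star_alg G (fun x => f (g x))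
| sa_adj f g : star_alg G f -> is_adjoint g f -> star_alg G g
| sa_ext f g : star_alg G f -> (forall x, f x = g x) -> star_alg G g.

Definition Cl_gens (D : op) (f : op) : Prop :=
  inA f \/ exists a b : op, inA a /\ inA b /\
                            f = (fun x => a (D (b x) - b (D x))).

Definition Cl (D : op) : op -> Prop := star_alg (Cl_gens D).

Definition commutant (S : op -> Prop) (xi : op) : Prop :=
  is_linear xi /\ forall eta, S eta -> forall x, xi (eta x) = eta (xi x).

Definition opposite (S : op -> Prop) (zeta : op) : Prop :=
  exists xi eta : op, S xi /\ is_adjoint eta xi /\
                      forall x, zeta x = J (eta (J x)).

Definition Hodge (S : op -> Prop) : Prop :=
  forall xi : op, commutant S xi <-> opposite S xi.

End HodgeDefs.

(* Main.v *)
(* Label the standard basis of H = C^4 (x) C^2 (x) C^4 by triples (i, s, j) and let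
   K1 be the 7 labels (i, s, 1) other than (1, v, 1), where s = v, w is the component
   of the pair.  Conjugation by J relabels (i, s, j) as (j, s', i), with s' the other
   component; let K2 be the image of K1.  (Label 1 is ord0 below.)  D1 and DR commute with A, so only D0 matters.
   If the four nondegeneracy conditions hold, Cl is the algebra M_7 + C + M_3 + M_3:
   all matrix units on K1, the scalars on K2, and e_ik (x) 1 on the two blocks
   {(i, s, j) : i, j > 1}.  Its commutant is obtained by exchanging K1 with K2 and
   M_3 (x) 1 with 1 (x) M_3, which is exactly what conjugation by J does.  In all
   cases Cl is contained in this algebra; if one of the conditions fails, a diagonal
   projection commutes with Cl while its conjugate by J is not in that algebra. *)
Require Import Defs.
From mathcomp Require Import all_boot all_algebra.
From mathcomp Require Import reals complex.
Set Implicit Arguments. Unset Strict Implicit. Unset Printing Implicit Defensive.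
Import GRing.Theory Num.Theory.
Local Open Scope ring_scope.

(** Both inclusions of the Hodge property come from one computation, [comm_K1_lunit_span], stated
    for an arbitrary class [P] of operators: once [P] is the commutant of the algebra, once it
    consists of the operators whose conjugate by J lies in the algebra. Two obstacles shape the
    proof that the algebra is large enough. A is only real, so an element ties lambda to its
    conjugate and the entries of a quaternion to each other; complex combinations separate them, and
    their commutators with D0 must follow, which is the purpose of [Clc]. Moreover only commutators
    with D0 are available; entries of D0 are reached through f [D0, g] = f D0 g when f g = 0. The
    four conditions concern row 2 of the terms of D0. From r0 = (2, v, 1), delta_21 leads to (1, w,
    1), the other delta_2j to the labels (l, w, 1) with l > 1, alpha to (3, v, 1) and (4, v, 1),
    while beta produces the v-block with j > 1. One non-zero entry in each vector suffices, since
    matrix units coming from A move it to every column. *)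

Section Sandwich.
Variables (K : comNzRingType) (n : nat).
Implicit Types (x y u v : 'M[K]_n) (a b c d : K).

Lemma sandwich_lin x y a b c u1 u2 v1 v2 :
  x *m (a *: (c *: u1 + v1) + b *: (c *: u2 + v2)) *m y =
  c *: (x *m (a *: u1 + b *: u2) *m y) + x *m (a *: v1 + b *: v2) *m y.
Proof.
rewrite scalemxAl scalemxAr -mulmxDl -mulmxDr; congr (_ *m _ *m _).
by rewrite !scalerDr !scalerA ![c * _]mulrC addrACA.
Qed.

(** The third factor acts on the right through its transpose, so two reversals of order cancel; this
    is what makes [tens] multiplicative in all three factors. *)
Lemma sandwichM x y x' y' (m m' : 'M[K]_2) i u1 u2 :
  x *m (m i ord0 *: (x' *m (m' ord0 ord0 *: u1 + m' ord0 ord_max *: u2) *m y'^T) +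
        m i ord_max *: (x' *m (m' ord_max ord0 *: u1 + m' ord_max ord_max *: u2) *m y'^T))
    *m y^T =
  (x *m x') *m ((m *m m') i ord0 *: u1 + (m *m m') i ord_max *: u2) *m (y *m y')^T.
Proof.
have mE j : (m *m m') i j = m i ord0 * m' ord0 j + m i ord_max * m' ord_max j.
  by rewrite mxE big_ord_recl big_ord1; congr (_ + m _ _ * m' _ _); apply: val_inj.
rewrite trmx_mul !mE !(mulmxDr, mulmxDl, =^~ scalemxAr, =^~ scalemxAl) !mulmxA.
by rewrite !scalerDr !scalerDl !scalerA -!addrA; congr (_ + _); rewrite addrCA.
Qed.

Lemma sandwich_delta x y k l i j : (x *m delta_mx k l *m y^T) i j = x i k * y j l.
Proof.
rewrite mxE (bigD1 l) //= big1 ?addr0 => [|l' nl].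
  rewrite mxE (bigD1 k) //= big1 ?addr0 => [|k' nk].
    by rewrite !mxE !eqxx mulr1.
  by rewrite !mxE (negbTE nk) mulr0.
rewrite mxE big1 ?mul0r // => k' _.
by rewrite !mxE (negbTE nl) andbF mulr0.
Qed.
End Sandwich.

(** * Operators as matrices in the standard basis of H *)

Section Operators.
Variable R : realType.
Local Notation C := R[i].
Local Notation H := (H R).
Local Notation op := (op R).
Implicit Types (f g : op) (u v : H) (x y : 'M[C]_4) (m : 'M[C]_2).

Lemma is_linearD f u v : is_linear f -> f (u + v) = f u + f v.
Proof. by move=> lf; rewrite -[u]scale1r lf !scale1r. Qed.

Lemma is_linear0 f : is_linear f -> f 0 = 0.
Proof. by move=> lf; apply: (addrI (f 0)); rewrite -is_linearD // !addr0. Qed.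

Lemma is_linearZ f (c : C) u : is_linear f -> f (c *: u) = c *: f u.
Proof. by move=> lf; rewrite -[c *: u]addr0 lf is_linear0 // addr0. Qed.

Lemma is_linearB f u v : is_linear f -> f (u - v) = f u - f v.
Proof. by move=> lf; rewrite -scaleN1r is_linearD // is_linearZ // scaleN1r. Qed.

Lemma is_linear_sum f (I : Type) (r : seq I) (P : pred I) (F : I -> H) :
  is_linear f -> f (\sum_(k <- r | P k) F k) = \sum_(k <- r | P k) f (F k).
Proof.
by move=> lf; apply: (big_morph f) => [u v|]; [apply: is_linearD | apply: is_linear0].
Qed.

Lemma opadd_linear f g : is_linear f -> is_linear g -> is_linear (opadd f g).
Proof. by move=> lf lg c u v; rewrite /opadd lf lg scalerDr addrACA. Qed.

Lemma scale_linear (c : C) f : is_linear f -> is_linear (fun u => c *: f u).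
Proof. by move=> lf d u v; rewrite lf scalerDr !scalerA mulrC. Qed.

Lemma comp_linear f g : is_linear f -> is_linear g -> is_linear (fun u => f (g u)).
Proof. by move=> lf lg c u v; rewrite lg lf. Qed.

Lemma sub_linear f g : is_linear f -> is_linear g -> is_linear (fun u => f u - g u).
Proof. by move=> lf lg c u v; rewrite lf lg scalerBr opprD addrACA. Qed.

Lemma sum_linear (I : Type) (r : seq I) (P : pred I) (F : I -> op) :
  (forall k, is_linear (F k)) -> is_linear (fun u => \sum_(k <- r | P k) F k u).
Proof.
move=> lF c u v; rewrite scaler_sumr -big_split; apply: eq_bigr => k _.
exact: lF.
Qed.

Definition tens_idx := ('I_4 * 'I_2 * 'I_4)%type.

Definition hcoord (p : tens_idx) u : C :=
  (if p.1.2 == i1 then u.1 else u.2) p.1.1 p.2.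

Definition bvec (p : tens_idx) : H :=
  (if p.1.2 == i1 then delta_mx p.1.1 p.2 else 0,
   if p.1.2 == i1 then 0 else delta_mx p.1.1 p.2).

Lemma ord2P (s : 'I_2) : s = i1 \/ s = i2.
Proof. by case: s => -[|[|//]] ?; [left|right]; apply: val_inj. Qed.

Lemma hcoord_lin p (c : C) u v : hcoord p (c *: u + v) = c * hcoord p u + hcoord p v.
Proof. by rewrite /hcoord; case: ifP => _; rewrite !mxE. Qed.

Lemma hcoordD p u v : hcoord p (u + v) = hcoord p u + hcoord p v.
Proof. by rewrite -[u]scale1r hcoord_lin scale1r mul1r. Qed.

Lemma hcoord0 p : hcoord p 0 = 0.
Proof. by rewrite /hcoord; case: ifP => _; rewrite mxE. Qed.

Lemma hcoordZ p (c : C) u : hcoord p (c *: u) = c * hcoord p u.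
Proof. by rewrite -[c *: u]addr0 hcoord_lin hcoord0 addr0. Qed.

Lemma hcoord_sum p (I : Type) (r : seq I) (P : pred I) (F : I -> H) :
  hcoord p (\sum_(k <- r | P k) F k) = \sum_(k <- r | P k) hcoord p (F k).
Proof. by apply: (big_morph (hcoord p)) => [u v|]; [apply: hcoordD | apply: hcoord0]. Qed.

Lemma hcoord_inj u v : (forall p, hcoord p u = hcoord p v) -> u = v.
Proof.
case: u v => [u1 u2] [v1 v2] e; congr pair; apply/matrixP => i j.
  by have := e (i, i1, j).
by have := e (i, i2, j).
Qed.

Lemma hcoord_bvec p q : hcoord p (bvec q) = (p == q)%:R.
Proof.
case: p q => [[i s] j] [[i' s'] j']; rewrite /hcoord /bvec /=.
rewrite -[RHS]/((((i == i') && (s == s')) && (j == j'))%:R).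
by case: (ord2P s) => ->; case: (ord2P s') => ->; rewrite /= mxE ?andbT ?andbF.
Qed.

Lemma bvec_sum u : u = \sum_p hcoord p u *: bvec p.
Proof.
apply: hcoord_inj => q; rewrite hcoord_sum (bigD1 q) //= hcoordZ hcoord_bvec eqxx mulr1.
rewrite big1 ?addr0 // => p pq.
by rewrite hcoordZ hcoord_bvec eq_sym (negbTE pq) mulr0.
Qed.

Lemma op_ext f g : is_linear f -> is_linear g ->
  (forall p q, hcoord p (f (bvec q)) = hcoord p (g (bvec q))) -> f =1 g.
Proof.
move=> lf lg e u; rewrite (bvec_sum u) !is_linear_sum //.
apply: eq_bigr => q _; rewrite !is_linearZ //; congr (_ *: _).
by apply: hcoord_inj => p; apply: e.
Qed.

Lemma tens_linear x m y : is_linear (tens x m y).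
Proof.
by move=> c u v; apply/pair_equal_spec; split; apply: sandwich_lin.
Qed.

(** The entries are those of a Kronecker product, so identities between [tens] operators reduce
    through [op_ext] to identities between scalars. *)
Lemma hcoord_tens x m y p q :
  hcoord p (tens x m y (bvec q)) = x p.1.1 q.1.1 * m p.1.2 q.1.2 * y p.2 q.2.
Proof.
case: p q => [[i s] j] [[k t] l]; rewrite /hcoord /tens /bvec /=.
by case: (ord2P s) => ->; case: (ord2P t) => -> /=;
  rewrite scaler0 ?addr0 ?add0r -scalemxAr -scalemxAl mxE sandwich_delta mulrA [m _ _ * _]mulrC.
Qed.

Lemma tensM x x' m m' y y' u :
  tens x m y (tens x' m' y' u) = tens (x *m x') (m *m m') (y *m y') u.
Proof.
by apply/pair_equal_spec; split; apply: sandwichM.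
Qed.
End Operators.

(** * Conjugation by J, adjoints, and commutation with a generated star-algebra *)

Section Adjoints.
Variable R : realType.
Local Notation C := R[i].
Local Notation H := (H R).
Local Notation op := (op R).
Implicit Types (f g : op) (u v : H) (x y : 'M[C]_4) (m : 'M[C]_2).

Definition oppi (s : 'I_2) : 'I_2 := if s == i1 then i2 else i1.
Definition swap_idx (p : tens_idx) : tens_idx := (p.2, oppi p.1.2, p.1.1).

Lemma oppiK : involutive oppi.
Proof. by move=> s; case: (ord2P s) => ->. Qed.

Lemma swap_idxK : involutive swap_idx.
Proof. by case=> [[i s] j]; rewrite /swap_idx /= oppiK. Qed.

Lemma hcoordJ p u : hcoord p (J u) = conjc (hcoord (swap_idx p) u).
Proof.
case: p => [[i s] j]; rewrite /hcoord /J /swap_idx /oppi /= /cmx.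
by case: (ord2P s) => -> /=; rewrite !mxE.
Qed.

Lemma JK u : J (J u) = u.
Proof. by apply: hcoord_inj => p; rewrite !hcoordJ swap_idxK conjcK. Qed.

Lemma J_lin (c : C) u v : J (c *: u + v) = conjc c *: J u + J v.
Proof. by apply: hcoord_inj => p; rewrite !(hcoordJ, hcoord_lin) rmorphD rmorphM. Qed.

Lemma JD u v : J (u + v) = J u + J v.
Proof. by apply: hcoord_inj => p; rewrite !(hcoordJ, hcoordD) rmorphD. Qed.

Lemma JZ (c : C) u : J (c *: u) = conjc c *: J u.
Proof. by apply: hcoord_inj => p; rewrite !(hcoordJ, hcoordZ) rmorphM. Qed.

Lemma J_bvec p : J (bvec R p) = bvec R (swap_idx p).
Proof.
apply: hcoord_inj => q; rewrite hcoordJ !hcoord_bvec rmorph_nat.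
by rewrite (inv_eq swap_idxK).
Qed.

Lemma conjJ_linear f : is_linear f -> is_linear (fun u => J (f (J u))).
Proof. by move=> lf c u v; rewrite J_lin lf J_lin conjcK. Qed.

Definition mflip m : 'M[C]_2 := \matrix_(s, t) conjc (m (oppi s) (oppi t)).

(** J swaps the outer indices, flips the middle one and conjugates scalars. Hence in D1 the three
    terms of D0 that end in [e4_11] begin with [e4_11], and the beta term begins with [1%:M - e4_11]
    followed by [e_22]. *)
Lemma conjJ_tens x m y u :
  J (tens x m y (J u)) = tens (map_mx (@conjc R) y) (mflip m) (map_mx (@conjc R) x) u.
Proof.
move: u; apply: op_ext => [|| p q]; [exact/conjJ_linear/tens_linear | exact: tens_linear |].
rewrite hcoordJ J_bvec !hcoord_tens !mxE !rmorphM /=.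
by rewrite mulrC [X in _ * X]mulrC mulrA.
Qed.

Lemma innerE u v : inner u v = \sum_p conjc (hcoord p u) * hcoord p v.
Proof.
have trE (a b : 'M[C]_4) : \tr (cmx a *m b) = \sum_i \sum_j conjc (a i j) * b i j.
  rewrite exchange_big; apply: eq_bigr => i _; rewrite mxE; apply: eq_bigr => j _.
  by rewrite !mxE.
rewrite /inner !trE -(pair_bigA _ (fun a j => conjc (hcoord (a, j) u) * hcoord (a, j) v)) /=.
rewrite -(pair_bigA _ (fun i s => \sum_j conjc (hcoord (i, s, j) u) * hcoord (i, s, j) v)) /=.
rewrite -big_split; apply: eq_bigr => i _.
by rewrite [RHS]big_ord_recl big_ord1 /hcoord /=.
Qed.

Lemma inner_bvec p v : inner (bvec R p) v = hcoord p v.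
Proof.
rewrite innerE (bigD1 p) //= hcoord_bvec eqxx rmorph1 mul1r big1 ?addr0 // => q qp.
by rewrite hcoord_bvec (negbTE qp) rmorph0 mul0r.
Qed.

Lemma inner_conj u v : inner u v = conjc (inner v u).
Proof.
by rewrite !innerE rmorph_sum; apply: eq_bigr => p _; rewrite rmorphM /= conjcK mulrC.
Qed.

Lemma inner_injl u v : (forall w, inner u w = inner v w) -> u = v.
Proof.
move=> e; apply: hcoord_inj => p; apply: (can_inj (@conjcK R)).
by rewrite -!inner_bvec -!inner_conj.
Qed.

Lemma inner_linr u (c : C) v w : inner u (c *: v + w) = c * inner u v + inner u w.
Proof.
rewrite !innerE mulr_sumr -big_split; apply: eq_bigr => p _ /=.
by rewrite hcoord_lin mulrDr mulrCA.
Qed.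

Lemma inner_linl (c : C) u v w :
  inner (c *: u + v) w = conjc c * inner u w + inner v w.
Proof. by rewrite inner_conj inner_linr rmorphD rmorphM /= -!inner_conj. Qed.

Lemma is_adjoint_sym f g : is_adjoint f g -> is_adjoint g f.
Proof. by move=> a u v; rewrite inner_conj -a -inner_conj. Qed.

(** The inner product is non-degenerate, so the adjoint identity alone forces linearity. This covers
    operators added by the adjoint rule of [star_alg], which are given only through that
    identity. *)
Lemma is_adjoint_linear f g : is_adjoint f g -> is_linear f.
Proof.
by move=> a c u v; apply: inner_injl => w; rewrite inner_linl !a inner_linl.
Qed.

Lemma adjoint_exists f : is_linear f -> exists g, is_adjoint f g.
Proof.
move=> lf; exists (fun u => \sum_p inner (f (bvec R p)) u *: bvec R p) => u v.
rewrite [RHS]innerE {1}(bvec_sum u) is_linear_sum //.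
rewrite inner_conj (big_morph (inner v) (id1 := 0) (op1 := +%R)); last 2 first.
- by move=> a b; rewrite -[a]scale1r inner_linr mul1r scale1r.
- by rewrite innerE big1 // => p _; rewrite hcoord0 mulr0.
rewrite rmorph_sum; apply: eq_bigr => p _ /=; rewrite -inner_conj is_linearZ //.
rewrite -[_ *: f _]addr0 inner_linl; set z := inner 0 v.
have -> : z = 0 by rewrite /z innerE big1 // => q _; rewrite hcoord0 rmorph0 mul0r.
rewrite addr0; congr (_ * _); rewrite hcoord_sum (bigD1 p) //= hcoordZ hcoord_bvec eqxx mulr1.
by rewrite big1 ?addr0 // => q qp; rewrite hcoordZ hcoord_bvec eq_sym (negbTE qp) mulr0.
Qed.

(** Some adjoint exists, and its matrix entries are forced to be those of [g]. *)
Lemma is_adjoint_kernel f g : is_linear f -> is_linear g ->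
  (forall p q, conjc (hcoord p (f (bvec R q))) = hcoord q (g (bvec R p))) -> is_adjoint f g.
Proof.
move=> lf lg e; have [h ah] := adjoint_exists lf.
have lh := is_adjoint_linear (is_adjoint_sym ah).
have gh : g =1 h.
  by apply: op_ext => // q p; rewrite -e -!inner_bvec -ah -inner_conj.
by move=> u v; rewrite gh.
Qed.

Lemma tens_adjoint x m y : is_adjoint (tens x m y) (tens (cmx x) (cmx m) (cmx y)).
Proof.
apply: is_adjoint_kernel => [||p q]; [exact: tens_linear | exact: tens_linear |].
by rewrite !hcoord_tens !rmorphM !mxE.
Qed.

(* Commuting with f does not pass to adjoints by itself: commutation with f and with
   its adjoint f' must be carried through the induction together. *)
Lemma star_alg_comm (G : op -> Prop) f f' : is_linear f -> is_adjoint f f' ->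
  (forall g, G g -> forall u, f (g u) = g (f u)) ->
  (forall g, G g -> forall u, f' (g u) = g (f' u)) ->
  forall g, star_alg G g -> forall u, f (g u) = g (f u).
Proof.
move=> lf af cf cf' g Gg.
have lf' := is_adjoint_linear (is_adjoint_sym af).
suff [] : (forall u, f (g u) = g (f u)) /\ (forall u, f' (g u) = g (f' u)) by [].
have af' := is_adjoint_sym af.
elim: Gg => {g} [g Gg | g h _ [IH1 IH2] _ [IH3 IH4] | c g _ [IH1 IH2]
  | g h _ [IH1 IH2] _ [IH3 IH4] | g h _ [IH1 IH2] ah | g h _ [IH1 IH2] e].
- by split; [apply: cf | apply: cf'].
- by split=> u; rewrite /opadd is_linearD // ?IH1 ?IH2 ?IH3 ?IH4.
- by split=> u; rewrite is_linearZ // ?IH1 ?IH2.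
- by split=> u; rewrite ?IH1 ?IH2 ?IH3 ?IH4.
- by split=> u; apply: inner_injl => w; rewrite ?(af, ah, af', IH1, IH2) -?ah.
- by split=> u; rewrite -!e ?IH1 ?IH2.
Qed.

End Adjoints.

(** * Operators commuting with the matrix units on K1 and with the left actions on the two blocks *)

Section Decomposition.
Variable R : realType.
Local Notation C := R[i].
Local Notation H := (H R).
Local Notation op := (op R).
Implicit Types (f g : op) (u v : H) (x y : 'M[C]_4) (m : 'M[C]_2).

Definition munit (p q : tens_idx) : op :=
  tens (delta_mx p.1.1 q.1.1) (delta_mx p.1.2 q.1.2) (delta_mx p.2 q.2).
Definition lunit (s : 'I_2) (i k : 'I_4) : op :=
  tens (delta_mx i k) (delta_mx s s) (1%:M - e4_11 R).
Definition runit (s : 'I_2) (j l : 'I_4) : op :=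
  tens (1%:M - e4_11 R) (delta_mx s s) (delta_mx j l).
Definition K1 (p : tens_idx) := (p.2 == ord0) && ((p.1.2 == i2) || (p.1.1 != ord0)).
Definition K2 (p : tens_idx) := (p.1.1 == ord0) && ((p.1.2 == i1) || (p.2 != ord0)).
Definition projK1 : op := opadd (tens 1%:M 1%:M (e4_11 R))
  (fun u => - 1 *: munit (ord0, i1, ord0) (ord0, i1, ord0) u).

Lemma pair3_eq (p q : tens_idx) :
  (p == q) = [&& p.1.1 == q.1.1, p.1.2 == q.1.2 & p.2 == q.2].
Proof. by case: p q => [[i s] j] [[k t] l]; rewrite andbA. Qed.

Lemma hcoord_munit p q a b :
  hcoord a (munit p q (bvec R b)) = ((a == p) && (b == q))%:R.
Proof.
rewrite hcoord_tens !mxE -!natrM !mulnb !pair3_eq; congr (_%:R).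
congr nat_of_bool; do 6![case: eqP => _ //=].
Qed.

Lemma munitE p q u : munit p q u = hcoord q u *: bvec R p.
Proof.
move: u; apply: op_ext => [||a b]; first exact: tens_linear.
  by move=> c u v; rewrite hcoord_lin scalerDl scalerA.
by rewrite hcoord_munit hcoordZ !hcoord_bvec mulrC -natrM mulnb (eq_sym q).
Qed.

Lemma one_sub_e4_11 (i j : 'I_4) : (1%:M - e4_11 R) i j = ((i == j) && (i != ord0))%:R.
Proof.
rewrite !mxE; case: (eqVneq i j) => [<-|ij] /=; rewrite ?andbb ?mulr1n.
  by case: (i == ord0); rewrite ?subrr ?subr0.
case: (eqVneq i ord0) => [i0|_] /=; rewrite mulr0n ?subr0 //.
by rewrite -i0 eq_sym (negbTE ij) subr0.
Qed.

Lemma hcoord_lunit s i k a b : hcoord a (lunit s i k (bvec R b)) =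
  [&& a.1.1 == i, a.1.2 == s, a.2 != ord0 & b == (k, s, a.2)]%:R.
Proof.
rewrite hcoord_tens one_sub_e4_11 !mxE -!natrM !mulnb !pair3_eq /= (eq_sym b.2).
by congr (nat_of_bool _)%:R; do 6![case: eqP => _ //=].
Qed.

Lemma hcoord_runit s j l a b : hcoord a (runit s j l (bvec R b)) =
  [&& a.1.1 != ord0, a.1.2 == s, a.2 == j & b == (a.1.1, s, l)]%:R.
Proof.
rewrite hcoord_tens one_sub_e4_11 !mxE -!natrM !mulnb !pair3_eq /= (eq_sym b.1.1).
by congr (nat_of_bool _)%:R; do 6![case: eqP => _ //=].
Qed.

Lemma hcoord_projK1 a b : hcoord a (projK1 (bvec R b)) = ((a == b) && K1 a)%:R.
Proof.
rewrite /projK1 /opadd hcoordD hcoordZ hcoord_munit hcoord_tens !mxE mulN1r.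
case: a b => [[i s] j] [[k t] l]; rewrite /K1 !pair3_eq /=.
rewrite -!natrM !mulnb.
case: (eqVneq i k) => [<-|ik] /=; last first.
  case: (eqVneq i ord0) ik => [->|_ _] /=; rewrite ?subr0 //.
  by rewrite eq_sym => /negbTE ->; rewrite /= ?andbF ?subr0.
case: (eqVneq s t) => [<-|st] /=; last first.
  case: (eqVneq s i1) st => [->|_ _] /=; rewrite ?andbF ?subr0 //.
  by rewrite eq_sym => /negbTE ->; rewrite /= ?andbF ?subr0.
case: (eqVneq j ord0) => [->|_] /=; last by rewrite !andbF subr0.
rewrite (eq_sym ord0); case: (l == ord0); rewrite ?andbF ?subr0 //=.
by case: (ord2P s) => -> /=; case: (i == ord0); rewrite ?subrr ?subr0.
Qed.

Section Span.
Variable f : op.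
Hypothesis lf : is_linear f.
Let X a b := hcoord a (f (bvec R b)).
Hypothesis f_munit : forall p q, K1 p -> K1 q -> forall u, f (munit p q u) = munit p q (f u).
Hypothesis f_lunit : forall s i k, i != ord0 -> k != ord0 ->
  forall u, f (lunit s i k u) = lunit s i k (f u).

Let commE p q a b : K1 p -> K1 q -> (q == b)%:R * X a p = (a == p)%:R * X q b.
Proof.
move=> kp kq; have := f_munit kp kq (bvec R b); rewrite !munitE is_linearZ // =>
  /(congr1 (hcoord a)).
by rewrite !hcoordZ !hcoord_bvec [RHS]mulrC.
Qed.

Lemma X_K1_col p a : K1 p -> a != p -> X a p = 0.
Proof. by move=> kp ap; have := commE a p kp kp; rewrite eqxx (negbTE ap) mul1r mul0r. Qed.

Lemma X_K1_row p a : K1 p -> p != a -> X p a = 0.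
Proof. by move=> kp ap; have := commE p a kp kp; rewrite eqxx (negbTE ap) mul1r mul0r. Qed.

Lemma X_K1_diag p q : K1 p -> K1 q -> X p p = X q q.
Proof. by move=> kp kq; have := commE p q kp kq; rewrite !eqxx !mul1r. Qed.

Let lunit_bvec s i k b : lunit s i k (bvec R b) =
  [&& b.1.1 == k, b.1.2 == s & b.2 != ord0]%:R *: bvec R (i, s, b.2).
Proof.
apply: hcoord_inj => a; rewrite hcoord_lunit hcoordZ hcoord_bvec -natrM mulnb !pair3_eq /=.
rewrite (eq_sym b.2); congr (nat_of_bool _)%:R.
by case: (eqVneq a.2 b.2) => [->|_] /=; rewrite ?andbT ?andbF;
  do 5?[case: eqP => _ //=].
Qed.

Let hcoord_lunitE s i k a u : hcoord a (lunit s i k u) =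
  [&& a.1.1 == i, a.1.2 == s & a.2 != ord0]%:R * hcoord (k, s, a.2) u.
Proof.
rewrite {1}(bvec_sum u) is_linear_sum; last exact: tens_linear.
rewrite hcoord_sum (bigD1 (k, s, a.2)) //= is_linearZ; last exact: tens_linear.
rewrite hcoordZ hcoord_lunit eqxx andbT mulrC big1 ?addr0 // => q /negbTE nq.
by rewrite is_linearZ ?hcoordZ ?hcoord_lunit ?nq ?andbF ?mulr0 //; apply: tens_linear.
Qed.

Let commQ s i k a b : i != ord0 -> k != ord0 ->
  [&& b.1.1 == k, b.1.2 == s & b.2 != ord0]%:R * X a (i, s, b.2) =
  [&& a.1.1 == i, a.1.2 == s & a.2 != ord0]%:R * X (k, s, a.2) b.
Proof.
move=> i0 k0; have := f_lunit s i0 k0 (bvec R b).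
by rewrite lunit_bvec is_linearZ // => /(congr1 (hcoord a)); rewrite hcoordZ hcoord_lunitE.
Qed.

Lemma X_col i s j a : i != ord0 -> j != ord0 ->
  ~~ [&& a.1.1 == i, a.1.2 == s & a.2 != ord0] -> X a (i, s, j) = 0.
Proof.
move=> i0 j0 /negbTE na; have := commQ s a (i, s, j) i0 i0.
by rewrite na /= !eqxx j0 mul0r mul1r.
Qed.

Lemma X_row i s j a : i != ord0 -> j != ord0 ->
  ~~ [&& a.1.1 == i, a.1.2 == s & a.2 != ord0] -> X (i, s, j) a = 0.
Proof.
move=> i0 j0 /negbTE na; have := commQ s (i, s, j) a i0 i0.
by rewrite na /= !eqxx j0 mul0r mul1r.
Qed.

Lemma X_shift i k s j l : i != ord0 -> k != ord0 -> j != ord0 -> l != ord0 ->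
  X (i, s, j) (i, s, l) = X (k, s, j) (k, s, l).
Proof.
move=> i0 k0 j0 l0; have := commQ s (i, s, j) (k, s, l) i0 k0.
by rewrite /= !eqxx j0 l0 !mul1r.
Qed.

Variable P : op -> Prop.
Hypothesis P_ext : forall g h, P g -> g =1 h -> P h.
Hypothesis P_add : forall g h, P g -> P h -> P (opadd g h).
Hypothesis P_scale : forall (c : C) g, P g -> P (fun u => c *: g u).
Hypothesis P_projK1 : P projK1.
Hypothesis P_munit : forall p q, K2 p -> K2 q -> P (munit p q).
Hypothesis P_runit : forall s j l, j != ord0 -> l != ord0 -> P (runit s j l).

Let P_sum (I : Type) (r : seq I) (Q : pred I) (F : I -> op) :
  (forall k, Q k -> P (F k)) -> P (fun u => \sum_(k <- r | Q k) F k u).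
Proof.
move=> PF; elim: r => [|k r IH].
  by apply: P_ext (P_scale 0 P_projK1) _ => u; rewrite big_nil scale0r.
have [Qk|nQk] := boolP (Q k).
  by apply: P_ext (P_add (PF k Qk) IH) _ => u; rewrite big_cons Qk.
by apply: P_ext IH _ => u; rewrite big_cons (negbTE nQk).
Qed.

Let one4 : 'I_4 := lift ord0 ord0.
Let w0 : tens_idx := (ord0, i2, ord0).

(** The 32 labels split as 7 + 7 + 9 + 9 into [K1], [K2] and the two blocks with both outer indices
    different from 1. Commuting with all units on [K1] makes [f] a scalar there and cuts it off from
    the rest; commuting with [e_ik] on a block makes it act through the right index only. On [K2]
    nothing is imposed. *)
Lemma comm_K1_lunit_span : P f.
Proof.
(* The coefficients are entries of [f]. The scalar on [K1] is read at [w0] and the block entries at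
   left index [one4]; by [X_K1_diag] and [X_shift] these choices do not matter. *)
pose F1 u := \sum_(pq : tens_idx * tens_idx | K2 pq.1 && K2 pq.2)
   X pq.1 pq.2 *: munit pq.1 pq.2 u.
pose F2 u := \sum_(sjl : 'I_2 * 'I_4 * 'I_4 | (sjl.1.2 != ord0) && (sjl.2 != ord0))
   X (one4, sjl.1.1, sjl.1.2) (one4, sjl.1.1, sjl.2) *: runit sjl.1.1 sjl.1.2 sjl.2 u.
have PF : P (opadd (fun u => X w0 w0 *: projK1 u) (opadd F1 F2)).
  apply: P_add; first exact: P_scale.
  apply: P_add; apply: P_sum.
    by move=> [p q] /andP[Kp Kq]; apply/P_scale/P_munit.
  by move=> [[s j] l] /andP[j0 l0]; apply/P_scale/P_runit.
apply: P_ext PF _.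
have lp : is_linear projK1 by apply: opadd_linear; [|apply: scale_linear]; apply: tens_linear.
apply: op_ext => // [|a b].
  apply: opadd_linear; first exact: scale_linear.
  by apply: opadd_linear; apply: sum_linear => k; apply/scale_linear/tens_linear.
rewrite /opadd 2!hcoordD hcoordZ hcoord_projK1 -/(X a b).
have F1E : hcoord a (F1 (bvec R b)) = (K2 a && K2 b)%:R * X a b.
  rewrite hcoord_sum; have [Kab|nK] := boolP (K2 a && K2 b); last first.
    rewrite mul0r big1 // => -[p q] /=; rewrite hcoordZ hcoord_munit.
    case: (eqVneq a p) => [<-|_ _]; rewrite ?mulr0 //.
    by case: (eqVneq b q) => [<-|_ _]; rewrite ?mulr0 // (negbTE nK).
  rewrite (bigD1 (a, b)) //= hcoordZ hcoord_munit !eqxx mulr1 mul1r big1 ?addr0 //.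
  move=> [p q] /= /andP[_]; rewrite xpair_eqE hcoordZ hcoord_munit eq_sym (eq_sym q).
  by move/negbTE ->; rewrite mulr0.
have F2E : hcoord a (F2 (bvec R b)) =
  [&& a.1.1 != ord0, a.2 != ord0, b.2 != ord0 & b.1 == a.1]%:R *
    X (one4, a.1.2, a.2) (one4, a.1.2, b.2).
  rewrite hcoord_sum; have [|nK] := boolP [&& _, _, _ & _]; last first.
    rewrite mul0r big1 // => -[[s j] l] /= /andP[j0 l0].
    rewrite hcoordZ hcoord_runit.
    case: and4P => [[a0 /eqP as_ /eqP aj /eqP bE]|]; last by rewrite mulr0.
    by move: nK; rewrite bE a0 aj j0 l0 /= -as_ -surjective_pairing eqxx.
  move=> /and4P[a0 a20 b20 /eqP ba].
  rewrite (bigD1 (a.1.2, a.2, b.2)) /= ?a20 ?b20 // hcoordZ hcoord_runit a0 !eqxx /=.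
  rewrite -surjective_pairing -ba -surjective_pairing eqxx mulr1 mul1r ba big1 ?addr0 //.
  move=> [[s j] l] /= /andP[_]; rewrite hcoordZ hcoord_runit => ne.
  case: and4P => [[_ /eqP as_ /eqP aj /eqP bE]|]; last by rewrite mulr0.
  by move: ne; rewrite as_ aj bE /= eqxx.
rewrite {}F1E {}F2E.
have [Ka|nKa] := boolP (K1 a).
  have -> : K2 a && K2 b = false.
    move: Ka; rewrite /K1 /K2; case: a => [[i s] j] /= /andP[/eqP -> /=].
    by case: (ord2P s) => -> /=; [move/negbTE -> | rewrite andbF].
  have -> : a.2 != ord0 = false by case/andP: Ka => ->.
  rewrite andbF !mul0r !addr0; case: (eqVneq a b) => [<-|ab] /=.
    by rewrite mulr1; apply: X_K1_diag.
  by rewrite mulr0 X_K1_row.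
rewrite andbF mulr0 add0r.
have [Ka2|nKa2] := boolP (K2 a).
  have [a10 a1] : a.1.1 = ord0 /\ ((a.1.2 == i1) || (a.2 != ord0)) by case/andP: Ka2 => /eqP.
  rewrite a10 /= mul0r addr0.
  have [Kb|nKb] := boolP (K2 b); first by rewrite mul1r.
  rewrite mul0r; apply/esym.
  have [Kb1|nKb1] := boolP (K1 b).
    by apply: X_K1_col => //; apply: contraNneq nKa => ->.
  (* A label outside [K1] and [K2] has both outer indices different from 1, so [b] lies in a
     block. *)
  case: b nKb nKb1 => [[k t] l]; rewrite /K1 /K2 /= => nKb nKb1.
  have k0 : k != ord0.
    move: nKb nKb1; case: (eqVneq k ord0) => //= _.
    by case: (ord2P t) => -> //=; rewrite negbK andbT => ->.
  have l0 : l != ord0 by move: nKb1; rewrite k0 orbT andbT.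
  by apply: X_col => //; rewrite a10 eq_sym (negbTE k0).
rewrite mul0r add0r.
case: a nKa nKa2 => [[i s] j]; rewrite /K1 /K2 /= => nKb nKb1.
have i0 : i != ord0.
  move: nKb nKb1; case: (eqVneq i ord0) => //= _.
  by case: (ord2P s) => -> //=; rewrite negbK andbT => /negbTE ->.
have j0 : j != ord0 by move: nKb; rewrite i0 orbT andbT.
rewrite i0 j0 /=; case: andP => [[l0 /eqP e]|nE].
  rewrite mul1r; case: b l0 e => [[k t] l] /= l0 [-> ->]; exact: X_shift.
rewrite mul0r X_row //; apply/and3P => -[/eqP e1 /eqP e2 l0]; case: nE; split => //.
by case: b e1 e2 {l0} => [[k t] l] /= -> ->.
Qed.
End Span.
End Decomposition.

(** * Products with matrix units *)

Section DeltaMatrices.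
Variables (K : comNzRingType) (n : nat).
Implicit Types M : 'M[K]_n.

Lemma delta_mulmx_delta p q M (a : 'I_p) b c (d : 'I_q) :
  delta_mx a b *m M *m delta_mx c d = M b c *: delta_mx a d.
Proof.
apply/matrixP => i j; rewrite mxE (bigD1 c) //= big1 ?addr0 => [|k kc]; last first.
  by rewrite !mxE (negbTE kc) mulr0.
rewrite mxE (bigD1 b) //= big1 ?addr0 => [|k kb]; last first.
  by rewrite !mxE (negbTE kb) andbF mul0r.
by rewrite !mxE !eqxx andbT mulrAC -natrM mulnb mulrC.
Qed.

Lemma delta_mulmx0 p M (a : 'I_p) b : (forall j, M b j = 0) -> delta_mx a b *m M = 0.
Proof.
move=> M0; apply/matrixP => i j; rewrite !mxE big1 // => k _; rewrite mxE.
by case: (eqVneq k b) => [->|_]; rewrite ?M0 ?mulr0 // andbF mul0r.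
Qed.

Lemma mulmx_delta0 q M c (d : 'I_q) : (forall i, M i c = 0) -> M *m delta_mx c d = 0.
Proof.
move=> M0; apply/matrixP => i j; rewrite !mxE big1 // => k _; rewrite mxE.
by case: (eqVneq k c) => [->|_]; rewrite ?M0 ?mul0r // mulr0.
Qed.

Lemma delta_mulmx_diag M a : (forall j, j != a -> M a j = 0) ->
  delta_mx a a *m M = M a a *: delta_mx a a.
Proof.
move=> M0; apply/matrixP => i j; rewrite !mxE (bigD1 a) //= big1 ?addr0 => [|k ka]; last first.
  by rewrite !mxE (negbTE ka) andbF mul0r.
rewrite !mxE eqxx andbT; case: (eqVneq j a) => [->|ja]; first by rewrite andbT mulrC.
by rewrite M0 // andbF !mulr0.
Qed.

Lemma mulmx_delta_diag M a : (forall i, i != a -> M i a = 0) ->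
  M *m delta_mx a a = M a a *: delta_mx a a.
Proof.
move=> M0; apply/matrixP => i j; rewrite !mxE (bigD1 a) //= big1 ?addr0 => [|k ka]; last first.
  by rewrite !mxE (negbTE ka) mulr0.
rewrite !mxE eqxx /=; case: (eqVneq i a) => [->|ia] //=.
by rewrite M0 // mul0r mulr0.
Qed.
End DeltaMatrices.

(** * Calculus of [tens] in each factor, and explicit entries of the matrices in A and D0 *)

Section TensAlgebra.
Variable R : realType.
Local Notation C := R[i].
Local Notation H := (H R).
Local Notation op := (op R).
Implicit Types (f g : op) (u v : H) (x y : 'M[C]_4) (m : 'M[C]_2).

Lemma tensZ (c : C) x m y u : tens (c *: x) m y u = c *: tens x m y u.
Proof.
move: u; apply: op_ext => [||p q]; [exact: tens_linear | exact/scale_linear/tens_linear |].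
by rewrite hcoordZ !hcoord_tens !mxE !mulrA.
Qed.

Lemma tensZm (c : C) x m y u : tens x (c *: m) y u = c *: tens x m y u.
Proof.
move: u; apply: op_ext => [||p q]; [exact: tens_linear | exact/scale_linear/tens_linear |].
by rewrite hcoordZ !hcoord_tens [(c *: m) _ _]mxE mulrCA [RHS]mulrA.
Qed.

Lemma tensD x x' m y u : tens (x + x') m y u = tens x m y u + tens x' m y u.
Proof.
move: u; apply: op_ext => [||p q].
- exact: tens_linear.
- by apply: (@opadd_linear _ (tens x m y)); apply: tens_linear.
- by rewrite hcoordD !hcoord_tens !mxE !mulrDl.
Qed.

Lemma tensDm x m m' y u : tens x (m + m') y u = tens x m y u + tens x m' y u.
Proof.
move: u; apply: op_ext => [||p q].
- exact: tens_linear.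
- by apply: (@opadd_linear _ (tens x m y)); apply: tens_linear.
- by rewrite hcoordD !hcoord_tens [(m + m') _ _]mxE mulrDr mulrDl.
Qed.

Lemma tensDy x m y y' u : tens x m (y + y') u = tens x m y u + tens x m y' u.
Proof.
move: u; apply: op_ext => [||p q].
- exact: tens_linear.
- by apply: (@opadd_linear _ (tens x m y)); apply: tens_linear.
- by rewrite hcoordD !hcoord_tens !mxE mulrDr.
Qed.

Lemma tensBy x m y y' u : tens x m (y - y') u = tens x m y u - tens x m y' u.
Proof. by apply: (addIr (tens x m y' u)); rewrite -[LHS]tensDy !subrK. Qed.

Lemma tens0 m y u : tens 0 m y u = 0.
Proof. by rewrite -(scale0r (0 : 'M[C]_4)) tensZ scale0r. Qed.

Lemma tens0m x y u : tens x 0 y u = 0.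
Proof. by rewrite -(scale0r (0 : 'M[C]_2)) tensZm scale0r. Qed.

Lemma tens0y x m u : tens x m 0 u = 0.
Proof.
move: u; apply: op_ext => [||p q]; first exact: tens_linear.
  by move=> c u v; rewrite addr0 scaler0.
by rewrite hcoord_tens hcoord0 mxE mulr0.
Qed.

Lemma tens_comm x x' m m' y y' u : x *m x' = x' *m x -> m *m m' = m' *m m ->
  y *m y' = y' *m y -> tens x m y (tens x' m' y' u) = tens x' m' y' (tens x m y u).
Proof. by move=> ex em ey; rewrite !tensM ex em ey. Qed.

Lemma e2_mul (s t s' t' : 'I_2) :
  delta_mx s t *m delta_mx s' t' = (t == s')%:R *: delta_mx s t' :> 'M[C]_2.
Proof. by rewrite mul_delta_mx_cond scaler_nat. Qed.

Lemma e2_sum1 : delta_mx i1 i1 + delta_mx i2 i2 = 1%:M :> 'M[C]_2.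
Proof.
apply/matrixP => s t; rewrite !mxE.
by case: (ord2P s) => ->; case: (ord2P t) => ->; rewrite /= ?addr0 ?add0r.
Qed.

Lemma cmx_delta p q (i : 'I_p) (j : 'I_q) : cmx (delta_mx i j : 'M[C]_(p, q)) = delta_mx j i.
Proof. by apply/matrixP => a b; rewrite !mxE andbC rmorph_nat. Qed.

Lemma cmx1 n : cmx (1%:M : 'M[C]_n) = 1%:M.
Proof. by apply/matrixP => a b; rewrite !mxE eq_sym rmorphMn rmorph1. Qed.

Lemma cmxB p q (x y : 'M[C]_(p, q)) : cmx (x - y) = cmx x - cmx y.
Proof. by apply/matrixP => a b; rewrite !mxE rmorphB. Qed.

Lemma conj_delta p q (i : 'I_p) (j : 'I_q) :
  map_mx (@conjc R) (delta_mx i j) = delta_mx i j.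
Proof. by apply/matrixP => a b; rewrite !mxE rmorph_nat. Qed.

Lemma conj1 n : map_mx (@conjc R) (1%:M : 'M[C]_n) = 1%:M.
Proof. by apply/matrixP => a b; rewrite !mxE rmorphMn rmorph1. Qed.

Lemma mflip_delta (s t : 'I_2) : mflip (delta_mx s t : 'M[C]_2) = delta_mx (oppi s) (oppi t).
Proof.
apply/matrixP => a b; rewrite !mxE rmorph_nat.
by rewrite !(inv_eq oppiK).
Qed.

Lemma mflip1 : mflip (1%:M : 'M[C]_2) = 1%:M.
Proof.
apply/matrixP => s t; rewrite !mxE rmorphMn rmorph1.
by rewrite (inj_eq (can_inj oppiK)).
Qed.

(** Indices start at 0: [ord0], [o1], [o2], [o3] stand for the labels 1, 2, 3, 4, so delta_21 is the
    entry at [o1], [ord0]. *)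
Definition o1 : 'I_4 := lift ord0 ord0.
Definition o2 : 'I_4 := lift ord0 (lift ord0 ord0).
Definition o3 : 'I_4 := ord_max.

Lemma ord4P (i : 'I_4) : [\/ i = ord0, i = o1, i = o2 | i = o3].
Proof.
case: i => -[|[|[|[|//]]]] ?;
  [constructor 1|constructor 2|constructor 3|constructor 4]; exact: val_inj.
Qed.

Lemma diag_lqE (l z w : C) : diag_lq l z w = mxl 4 4
  [:: [:: l; 0; 0; 0]; [:: 0; conjc l; 0; 0]; [:: 0; 0; z; w]; [:: 0; 0; - conjc w; conjc z]].
Proof.
apply/matrixP => i j; rewrite [RHS]mxE /diag_lq.
case: i => -[|[|[|[|//]]]] ?; case: j => -[|[|[|[|//]]]] ?;
  do ![rewrite !mxE /=; (case: splitP => // -[[|[|//]] ? /=] // _ || idtac)];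
  by rewrite ?mulr1n.
Qed.

Lemma XmxE (a b c d : C) : Xmx (mxl 2 2 [:: [:: a; b]; [:: c; d]]) = mxl 4 4
  [:: [:: 0; 0; a; b]; [:: 0; 0; c; d]; [:: conjc a; conjc c; 0; 0]; [:: conjc b; conjc d; 0; 0]].
Proof.
apply/matrixP => i j; rewrite [RHS]mxE /Xmx.
case: i => -[|[|[|[|//]]]] ?; case: j => -[|[|[|[|//]]]] ?;
  do ![rewrite !mxE /=; (case: splitP => // -[[|[|//]] ? /=] // _ || idtac)];
  by rewrite ?mulr1n.
Qed.
End TensAlgebra.

Local Opaque tens.

Lemma addrK2 (V : zmodType) (x y p q : V) : (x + p + q) - (y + p + q) = x - y.
Proof. by rewrite -(addrA x) -(addrA y) opprD addrACA subrr addr0. Qed.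

(** * Commutation with A, and reduction of D to D0 *)

Section Commutation.
Variable R : realType.
Local Notation C := R[i].
Local Notation H := (H R).
Local Notation op := (op R).
Implicit Types (f g : op) (u v : H) (x y : 'M[C]_4) (m : 'M[C]_2).

Lemma comm_opadd f g h : is_linear f -> (forall u, f (g u) = g (f u)) ->
  (forall u, f (h u) = h (f u)) -> forall u, f (opadd g h u) = opadd g h (f u).
Proof. by move=> lf fg fh u; rewrite /opadd (is_linearD _ _ lf) fg fh. Qed.

Lemma comm_D1_opadd f g h : is_linear f -> (forall u, f (D1 g u) = D1 g (f u)) ->
  (forall u, f (D1 h u) = D1 h (f u)) -> forall u, f (D1 (opadd g h) u) = D1 (opadd g h) (f u).
Proof. by move=> lf fg fh u; rewrite /D1 /opadd !JD (is_linearD _ _ lf) fg fh. Qed.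

Lemma comm_D1_tens f x m y :
  (forall u, f (tens (map_mx (@conjc R) y) (mflip m) (map_mx (@conjc R) x) u) =
     tens (map_mx (@conjc R) y) (mflip m) (map_mx (@conjc R) x) (f u)) ->
  forall u, f (D1 (tens x m y) u) = D1 (tens x m y) (f u).
Proof. by move=> e u; rewrite /D1 [LHS](congr1 f (conjJ_tens _ _ _ _)) e conjJ_tens. Qed.

Lemma diag_lm00 (l : C) a : diag_lm l a ord0 ord0 = l.
Proof.
rewrite /diag_lm !mxE; case: splitP => // k /= _.
rewrite !mxE; case: splitP => // j /= _.
by rewrite !mxE !ord1 eqxx mulr1n.
Qed.

Lemma diag_lm0r (l : C) a j : j != ord0 -> diag_lm l a ord0 j = 0.
Proof.
move=> j0; rewrite /diag_lm !mxE; case: splitP => // k /= _.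
rewrite !mxE; case: splitP => [k' /= e|k' /= e]; last by rewrite mxE.
by case/negP: j0; apply/eqP/val_inj; rewrite /= e ord1.
Qed.

Lemma diag_lm0l (l : C) a j : j != ord0 -> diag_lm l a j ord0 = 0.
Proof.
move=> j0; rewrite /diag_lm !mxE; case: splitP => /= [k e|k e].
  by case/negP: j0; apply/eqP/val_inj; rewrite /= e ord1.
by rewrite !mxE; case: splitP => // k' /= _; rewrite mxE.
Qed.

Lemma Aop_linear (l z w : C) a : is_linear (Aop l z w a).
Proof. by apply: opadd_linear; apply: tens_linear. Qed.

Lemma inA_linear f : inA f -> is_linear f.
Proof. by move=> [l [z [w [a ->]]]]; apply: Aop_linear. Qed.

Lemma e00E : e4_11 R = delta_mx ord0 ord0. Proof. by []. Qed.

Lemma diag_lq_e00 (l z w : C) :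
  (diag_lq l z w *m e4_11 R = l *: e4_11 R) * (e4_11 R *m diag_lq l z w = l *: e4_11 R).
Proof.
by rewrite e00E mulmx_delta_diag ?delta_mulmx_diag; [rewrite diag_lqE mxE|..] => // i i0;
  rewrite diag_lqE mxE; case: (ord4P i) i0 => ->.
Qed.

Lemma diag_lm_e00 (l : C) a :
  (diag_lm l a *m e4_11 R = l *: e4_11 R) * (e4_11 R *m diag_lm l a = l *: e4_11 R).
Proof.
by rewrite e00E mulmx_delta_diag ?delta_mulmx_diag; [rewrite diag_lm00|..] => // i i0;
  rewrite ?diag_lm0r ?diag_lm0l.
Qed.

(** The same lambda sits in the corner of [diag_lq] and of [diag_lm], so an element of A acts on the
    range of [e_11 (x) 1 (x) 1] as a scalar, whatever the middle factor [m]. *)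
Lemma inA_comm_e00 f m y u : inA f ->
  f (tens (e4_11 R) m y u) = tens (e4_11 R) m y (f u).
Proof.
move=> [l [z [w [a ->]]]].
have tD : is_linear (tens (e4_11 R) m y) := tens_linear _ _ _.
rewrite /Aop /opadd (is_linearD _ _ tD) 4!tensM !mul1mx !mulmx1.
rewrite !diag_lq_e00 !diag_lm_e00 4!tensZ -[LHS]scalerDr -[RHS]scalerDr.
rewrite -[X in _ *: X = _]tensDm -[X in _ = _ *: X]tensDm -mulmxDl -mulmxDr.
by rewrite (@e2_sum1 R) mulmx1 mul1mx.
Qed.

Lemma inA_comm_i1 f x y u : (forall l z w : C, diag_lq l z w *m x = x *m diag_lq l z w) ->
  inA f -> f (tens x (e2 R i1 i1) y u) = tens x (e2 R i1 i1) y (f u).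
Proof.
move=> cx [l [z [w [a ->]]]].
have tD : is_linear (tens x (e2 R i1 i1) y) := tens_linear _ _ _.
rewrite /Aop /opadd (is_linearD _ _ tD) 4!tensM !mul1mx !mulmx1 cx.
by rewrite /e2 !e2_mul /= !scale0r 2!tens0m.
Qed.

Lemma inA_comm_i2 f x y u : (forall (l : C) a, diag_lm l a *m x = x *m diag_lm l a) ->
  inA f -> f (tens x (e2 R i2 i2) y u) = tens x (e2 R i2 i2) y (f u).
Proof.
move=> cx [l [z [w [a ->]]]].
have tD : is_linear (tens x (e2 R i2 i2) y) := tens_linear _ _ _.
rewrite /Aop /opadd (is_linearD _ _ tD) 4!tensM !mul1mx !mulmx1 cx.
by rewrite /e2 !e2_mul /= !scale0r 2!tens0m.
Qed.

Lemma diag_lm_comm_1e00 (l : C) a :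
  diag_lm l a *m (1%:M - e4_11 R) = (1%:M - e4_11 R) *m diag_lm l a.
Proof. by rewrite mulmxBr mulmxBl mulmx1 mul1mx !diag_lm_e00. Qed.

Lemma diag_lq_comm_1e00 (l z w : C) :
  diag_lq l z w *m (1%:M - e4_11 R) = (1%:M - e4_11 R) *m diag_lq l z w.
Proof. by rewrite mulmxBr mulmxBl mulmx1 mul1mx !diag_lq_e00. Qed.

Lemma conj_e00 : map_mx (@conjc R) (e4_11 R) = e4_11 R.
Proof. exact: conj_delta. Qed.

Lemma conj_1e00 : map_mx (@conjc R) (1%:M - e4_11 R) = 1%:M - e4_11 R.
Proof. by rewrite map_mxB conj1 conj_e00. Qed.

Variables a13 a14 a23 a24 b13 b14 b23 b24 d12 d13 d14 d21 d22 d23 d24 U : C.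
Let D := Dirac a13 a14 a23 a24 b13 b14 b23 b24 d12 d13 d14 d21 d22 d23 d24 U.
Let D0' := D0 a13 a14 a23 a24 b13 b14 b23 b24 d12 d13 d14 d21 d22 d23 d24.

Lemma D0_linear : is_linear D0'.
Proof. by do 2![apply: opadd_linear]; apply: tens_linear. Qed.

Lemma Dirac_linear : is_linear D.
Proof.
apply: opadd_linear; last exact: tens_linear.
exact: (opadd_linear D0_linear (conjJ_linear D0_linear)).
Qed.

(** By [conjJ_tens] three terms of D1 have left factor [e4_11]; the beta term has left part
    [(1 - e_11) (x) e_22], and [1 - e_11] commutes with every [diag_lm]. *)
Lemma inA_comm_D1 f u : inA f -> f (D1 D0' u) = D1 D0' (f u).
Proof.
move=> fA; have lf := inA_linear fA.
move: u; apply: (comm_D1_opadd lf); apply: (comm_D1_opadd lf).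
- by apply: comm_D1_tens => u; rewrite conj_e00 inA_comm_e00.
- apply: comm_D1_tens => u; rewrite conj_1e00 mflip_delta.
  by apply: inA_comm_i2 fA => *; apply: diag_lm_comm_1e00.
- by apply: comm_D1_tens => u; rewrite conj_e00 inA_comm_e00.
- by apply: comm_D1_tens => u; rewrite conj_e00 inA_comm_e00.
Qed.

Lemma inA_comm_DR f u : inA f -> f (DR U u) = DR U (f u).
Proof. exact: inA_comm_e00. Qed.

Lemma Dirac_commutator f u : inA f -> D (f u) - f (D u) = D0' (f u) - f (D0' u).
Proof.
move=> fA; have lf := inA_linear fA.
have DE v : D v = D0' v + D1 D0' v + DR U v by [].
rewrite (DE u) (DE (f u)) 2!(is_linearD _ _ lf) (inA_comm_D1 _ fA) (inA_comm_DR _ fA).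
exact: addrK2.
Qed.

(** Reduces commutation with the whole algebra to commutation with A and D0, checked for an operator
    and its adjoint. For matrix units the adjoint is again of the same kind, and the projections
    used below are self-adjoint. *)
Lemma Cl_comm f f' : is_adjoint f f' ->
  (forall g, inA g -> forall u, f (g u) = g (f u)) ->
  (forall g, inA g -> forall u, f' (g u) = g (f' u)) ->
  (forall u, f (D0' u) = D0' (f u)) -> (forall u, f' (D0' u) = D0' (f' u)) ->
  forall g, Cl D g -> forall u, f (g u) = g (f u).
Proof.
move=> af fA fA' fD fD'.
have lf := is_adjoint_linear af; have lf' := is_adjoint_linear (is_adjoint_sym af).
have key h : is_linear h -> (forall g, inA g -> forall u, h (g u) = g (h u)) ->
    (forall u, h (D0' u) = D0' (h u)) -> forall g, Cl_gens D g -> forall u, h (g u) = g (h u).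
  move=> lh hA hD g [/hA //|[a [b [aA [bA ->]]]]] u.
  have E v : a (D (b v) - b (D v)) = a (D0' (b v) - b (D0' v)) :=
    congr1 a (Dirac_commutator v bA).
  apply: (etrans (congr1 h (E u))); apply: (etrans _ (esym (E (h u)))).
  rewrite (hA a aA) (is_linearB _ _ lh).
  by rewrite (hD (b u)) (hA b bA u) (hA b bA (D0' u)) (hD u).
exact: (star_alg_comm lf af (key _ lf fA fD) (key _ lf' fA' fD')).
Qed.
End Commutation.

(** * Operators commuting with the algebra, and the inclusion of its opposite in its commutant *)

Section Commutant.
Variable R : realType.
Local Notation C := R[i].
Local Notation H := (H R).
Local Notation op := (op R).
Implicit Types (f g : op) (u v : H) (x y : 'M[C]_4) (m : 'M[C]_2).

Lemma tens_mul0 x x' m m' y y' u : [\/ x *m x' = 0, m *m m' = 0 | y *m y' = 0] ->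
  tens x m y (tens x' m' y' u) = 0.
Proof. by rewrite tensM; case=> ->; [apply: tens0 | apply: tens0m | apply: tens0y]. Qed.

Lemma tens_comm0 x x' m m' y y' u :
  [\/ x *m x' = 0, m *m m' = 0 | y *m y' = 0] ->
  [\/ x' *m x = 0, m' *m m = 0 | y' *m y = 0] ->
  tens x m y (tens x' m' y' u) = tens x' m' y' (tens x m y u).
Proof. by move=> e e'; rewrite (tens_mul0 _ e) (tens_mul0 _ e'). Qed.

Lemma munit_adjoint p q : is_adjoint (@munit R p q) (munit q p).
Proof. by have := tens_adjoint (delta_mx p.1.1 q.1.1 : 'M[C]_4)
  (delta_mx p.1.2 q.1.2) (delta_mx p.2 q.2); rewrite !cmx_delta. Qed.

Lemma cmx_e00 : cmx (e4_11 R) = e4_11 R. Proof. exact: cmx_delta. Qed.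

Lemma cmx_1e00 : cmx (1%:M - e4_11 R) = 1%:M - e4_11 R.
Proof. by rewrite cmxB cmx1 cmx_e00. Qed.

Lemma runit_adjoint s j l : is_adjoint (@runit R s j l) (runit s l j).
Proof. by have := tens_adjoint (1%:M - e4_11 R)
  (delta_mx s s) (delta_mx j l : 'M[C]_4); rewrite !cmx_delta cmx_1e00. Qed.

Lemma lunit_adjoint s i k : is_adjoint (@lunit R s i k) (lunit s k i).
Proof. by have := tens_adjoint (delta_mx i k : 'M[C]_4)
  (delta_mx s s) (1%:M - e4_11 R); rewrite !cmx_delta cmx_1e00. Qed.

Lemma e00_delta j l : j != ord0 -> e4_11 R *m delta_mx j l = 0 :> 'M[C]_4.
Proof. by move=> j0; rewrite mul_delta_mx_cond eq_sym (negbTE j0). Qed.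

Lemma delta_e00 j l : l != ord0 -> delta_mx j l *m e4_11 R = 0 :> 'M[C]_4.
Proof. by move=> j0; rewrite mul_delta_mx_cond (negbTE j0). Qed.

Lemma e00_id : e4_11 R *m e4_11 R = e4_11 R.
Proof. exact: mul_delta_mx. Qed.

Lemma sub_e00_id : (1%:M - e4_11 R) *m (1%:M - e4_11 R) = 1%:M - e4_11 R.
Proof. by rewrite mulmxBl mul1mx mulmxBr mulmx1 e00_id subrr subr0. Qed.

Variables a23 a24 b23 b24 d21 d22 d23 d24 U : C.
Let D := Dirac 0 0 a23 a24 0 0 b23 b24 0 0 0 d21 d22 d23 d24 U.
Let D0' := D0 0 0 a23 a24 0 0 b23 b24 0 0 0 d21 d22 d23 d24.
Let X2 (c d : C) := Xmx (mxl 2 2 [:: [:: 0; 0]; [:: c; d]]).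
Let Y := Ymx 0 0 0 d21 d22 d23 d24.

(** The vanishing of the first rows of alpha and beta enters here: it detaches label 1 from both
    [Xmx] terms. *)
Lemma X2_00 c d : (e4_11 R *m X2 c d = 0) * (X2 c d *m e4_11 R = 0).
Proof.
split; [apply: delta_mulmx0 => i|apply: mulmx_delta0 => i]; rewrite /X2 XmxE !conjc0 mxE;
  by case: (ord4P i) => ->; rewrite /=.
Qed.

Lemma Y_row j k : j != o1 -> Y j k = 0.
Proof. by rewrite mxE; case: (ord4P j) => ->; case: (ord4P k) => ->. Qed.

Lemma Y_delta i j : j != o1 ->
  (delta_mx i j *m Y = 0 :> 'M[C]_4) * (cmx Y *m delta_mx j i = 0 :> 'M[C]_4).
Proof.
move=> j1; split; [apply: delta_mulmx0 => k|apply: mulmx_delta0 => k]; first exact: Y_row.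
by rewrite 2!mxE Y_row // conjc0.
Qed.

Lemma comm_D0 f : is_linear f ->
  (forall u, f (tens (X2 a23 a24) (e2 R i1 i1) (e4_11 R) u) =
     tens (X2 a23 a24) (e2 R i1 i1) (e4_11 R) (f u)) ->
  (forall u, f (tens (X2 b23 b24) (e2 R i1 i1) (1%:M - e4_11 R) u) =
     tens (X2 b23 b24) (e2 R i1 i1) (1%:M - e4_11 R) (f u)) ->
  (forall u, f (tens Y (e2 R i1 i2) (e4_11 R) u) = tens Y (e2 R i1 i2) (e4_11 R) (f u)) ->
  (forall u, f (tens (cmx Y) (e2 R i2 i1) (e4_11 R) u) =
     tens (cmx Y) (e2 R i2 i1) (e4_11 R) (f u)) ->
  forall u, f (D0' u) = D0' (f u).
Proof.
move=> lf h1 h2 h3 h4.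
exact: (comm_opadd lf (comm_opadd lf h1 h2) (comm_opadd lf h3 h4)).
Qed.

Lemma e2_mul0 (s t s' t' : 'I_2) : t != s' -> delta_mx s t *m delta_mx s' t' = 0 :> 'M[C]_2.
Proof. by move=> ts; rewrite mul_delta_mx_cond (negbTE ts). Qed.

(** [e_11] annihilates [X2] on both sides, and [Y] from the left because only row 2 of [Y] survives.
    The product of [Y (x) e_12 (x) e_11] with the unit could be non-zero only for a target [p] equal
    to (1, w, 1), the label that [K2] leaves out; the term of the adjoint of [Y] restricts [q] in
    the same way. *)
Lemma munit_D0 p q : K2 p -> K2 q -> forall u, munit p q (D0' u) = D0' (munit p q u).
Proof.
case: p q => [[i s] j] [[k t] l] /andP[/= /eqP -> hp] /andP[/= /eqP -> hq].
have x1 c d : ((delta_mx ord0 ord0 : 'M[C]_4) *m X2 c d = 0) *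
    (X2 c d *m (delta_mx ord0 ord0 : 'M[C]_4) = 0).
  exact: X2_00.
apply: comm_D0 => [|u|u|u|u]; first exact: tens_linear.
- by apply: tens_comm0; constructor 1; rewrite x1.
- by apply: tens_comm0; constructor 1; rewrite x1.
- apply: tens_comm0; first by constructor 1; rewrite (Y_delta ord0).
  case/orP: hp => [/eqP ->|j0]; first by constructor 2; apply: e2_mul0.
  by constructor 3; apply: e00_delta.
- apply: tens_comm0; last by constructor 1; rewrite (Y_delta ord0).
  case/orP: hq => [/eqP ->|j0]; first by constructor 2; apply: e2_mul0.
  by constructor 3; apply: delta_e00.
Qed.

(** With [j] and [l] different from 1, only the beta term meets this operator, and [X2] commutes
    with [1 - e_11]. *)
Lemma runit_D0 s j l : j != ord0 -> l != ord0 ->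
  forall u, runit s j l (D0' u) = D0' (runit s j l u).
Proof.
move=> j0 l0; apply: comm_D0 => [|u|u|u|u]; first exact: tens_linear.
- by apply: tens_comm0; constructor 3; rewrite (e00_delta, delta_e00).
- apply: tens_comm.
  + by rewrite mulmxBl mulmxBr !X2_00 mul1mx mulmx1.
  + by rewrite !mul_delta_mx_cond; case: (ord2P s) => ->.
  + by rewrite mulmxBl mulmxBr mul1mx mulmx1 e00_delta // delta_e00.
- by apply: tens_comm0; constructor 3; rewrite (e00_delta, delta_e00).
- by apply: tens_comm0; constructor 3; rewrite (e00_delta, delta_e00).
Qed.

Lemma e00_D0 u : tens 1%:M 1%:M (e4_11 R) (D0' u) = D0' (tens 1%:M 1%:M (e4_11 R) u).
Proof.
move: u; apply: comm_D0 => [|u|u|u|u]; first exact: tens_linear;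
  apply: tens_comm; rewrite ?mul1mx ?mulmx1 //.
by rewrite mulmxBl mulmxBr mul1mx mulmx1 e00_id.
Qed.

Lemma runit_inA s j l f u : inA f -> f (runit s j l u) = runit s j l (f u).
Proof.
by case: (ord2P s) => -> fA; [apply: inA_comm_i1 fA | apply: inA_comm_i2 fA] => *;
  [apply: diag_lq_comm_1e00 | apply: diag_lm_comm_1e00].
Qed.

Lemma munit_inA p q f u : K2 p -> K2 q -> inA f -> f (munit p q u) = munit p q (f u).
Proof.
case: p q => [[i s] j] [[k t] l] /andP[/= /eqP -> _] /andP[/= /eqP -> _] fA.
exact: inA_comm_e00.
Qed.

Lemma e00_inA f u : inA f ->
  f (tens 1%:M 1%:M (e4_11 R) u) = tens 1%:M 1%:M (e4_11 R) (f u).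
Proof.
move=> [l [z [w [a ->]]]]; apply/esym; move: u; apply: comm_opadd => [|u|u];
  [exact: tens_linear | |]; by apply: tens_comm; rewrite ?mul1mx ?mulmx1.
Qed.

Lemma munit_Cl p q g u : K2 p -> K2 q -> Cl D g -> munit p q (g u) = g (munit p q u).
Proof.
move=> Kp Kq gD; apply: Cl_comm (munit_adjoint p q) _ _ _ _ _ gD u => [h hA u|h hA u||].
- by rewrite munit_inA.
- by rewrite munit_inA.
- exact: munit_D0.
- exact: munit_D0.
Qed.

Lemma runit_Cl s j l g u : j != ord0 -> l != ord0 -> Cl D g ->
  runit s j l (g u) = g (runit s j l u).
Proof.
move=> j0 l0 gD; apply: Cl_comm (runit_adjoint s j l) _ _ _ _ _ gD u => [h hA u|h hA u||].
- by rewrite runit_inA.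
- by rewrite runit_inA.
- exact: runit_D0.
- exact: runit_D0.
Qed.

Lemma e00_Cl g u : Cl D g -> tens 1%:M 1%:M (e4_11 R) (g u) = g (tens 1%:M 1%:M (e4_11 R) u).
Proof.
have aj := tens_adjoint (1%:M) 1%:M (e4_11 R); rewrite !cmx1 cmx_e00 in aj.
move=> gD; apply: Cl_comm aj _ _ _ _ _ gD u => [h hA u|h hA u||].
- by rewrite e00_inA.
- by rewrite e00_inA.
- exact: e00_D0.
- exact: e00_D0.
Qed.

Lemma projK1_Cl g u : is_linear g -> Cl D g -> projK1 (g u) = g (projK1 u).
Proof.
move=> lg gD; rewrite /projK1 /opadd (is_linearD _ _ lg) (is_linearZ _ _ lg).
by rewrite e00_Cl // munit_Cl.
Qed.

Lemma Cl_linear g : Cl D g -> is_linear g.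
Proof.
elim=> {g} [g|f g _ lf _ lg|c f _ lf|f g _ lf _ lg|f g _ _ a|f g _ lf e].
- move=> [/inA_linear //|[a [b [/inA_linear la [/inA_linear lb ->]]]]].
  have lD : is_linear D := Dirac_linear _ _ _ _ _ _ _ _ _ _ _ _ _ _ _ _.
  exact: (comp_linear la (sub_linear (comp_linear lD lb) (comp_linear lb lD))).
- exact: opadd_linear.
- exact: scale_linear.
- exact: comp_linear.
- exact: is_adjoint_linear a.
- by move=> c u v; rewrite -!e lf.
Qed.

Lemma K_swap p : K1 (swap_idx p) = K2 p.
Proof. by case: p => [[i s] j]; rewrite /K1 /K2 /=; case: (ord2P s) => ->. Qed.

Lemma K2_swap p : K2 (swap_idx p) = K1 p.
Proof. by rewrite -K_swap swap_idxK. Qed.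

Lemma oppi_delta s t (i j k l : 'I_4) u :
  J (munit (i, s, j) (k, t, l) (J u)) = munit (j, oppi s, i) (l, oppi t, k) u.
Proof. by rewrite conjJ_tens !conj_delta mflip_delta. Qed.

Lemma munit_J p q u : J (munit p q (J u)) = munit (swap_idx p) (swap_idx q) u.
Proof. by case: p q => [[i s] j] [[k t] l]; rewrite oppi_delta. Qed.

Lemma runit_J s j l u : J (runit s j l (J u)) = lunit (oppi s) j l u.
Proof. by rewrite conjJ_tens conj_1e00 conj_delta mflip_delta. Qed.

(** An element of the algebra commutes with the units on [K2] and with every [runit] off index 1.
    Conjugation by J turns these into the hypotheses of [comm_K1_lunit_span], and each operator
    spanning its conclusion commutes with the algebra. *)
Lemma opposite_sub_commutant f : Cl D f ->
  forall g, Cl D g -> forall u, J (f (J (g u))) = g (J (f (J u))).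
Proof.
move=> fD.
have lf := Cl_linear fD.
have lJ := conjJ_linear lf.
pose P (h : op) := forall g, Cl D g -> forall u, h (g u) = g (h u).
suff : P (fun u => J (f (J u))) by [].
apply: comm_K1_lunit_span => [//|p q Kp Kq u|s i k i0 k0 u|h k hP e g gD u
    |h k hP kP g gD u|c h hP g gD u|g gD u|p q Kp Kq g gD u|s j l j0 l0 g gD u].
- have E v : munit p q v = J (munit (swap_idx p) (swap_idx q) (J v)).
    by rewrite munit_J !swap_idxK.
  by rewrite (E u) (E (J (f (J u)))) !JK (munit_Cl _ _ _ fD) // K2_swap.
- have E v : lunit s i k v = J (runit (oppi s) i k (J v)) by rewrite runit_J oppiK.
  by rewrite (E u) (E (J (f (J u)))) !JK (runit_Cl _ _ _ _ fD).
- by rewrite -!e hP.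
- by rewrite /opadd hP // kP // (is_linearD _ _ (Cl_linear gD)).
- by rewrite hP // (is_linearZ _ _ (Cl_linear gD)).
- by apply: projK1_Cl (Cl_linear gD) gD.
- exact: munit_Cl.
- exact: runit_Cl.
Qed.
End Commutant.

(** * Under the four conditions the algebra contains all the expected matrix units *)

Section Membership.
Variable R : realType.
Local Notation C := R[i].
Local Notation H := (H R).
Local Notation op := (op R).
Implicit Types (f g : op) (u v : H) (x y : 'M[C]_4) (m : 'M[C]_2).

Definition imI : C := (0 +i* 1)%C.

Lemma mul_imI : imI * imI = -1.
Proof. by apply/eqP; rewrite eq_complex /= !mul0r !mulr0 !mulr1 sub0r addr0 oppr0 !eqxx. Qed.

Lemma conj_imI : conjc imI = - imI.
Proof. by apply/eqP; rewrite eq_complex /= oppr0 !eqxx. Qed.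

Lemma diag_lm0 l : diag_lm l (0 : 'M[C]_3) = l *: delta_mx ord0 ord0.
Proof.
apply/matrixP => i j; rewrite [RHS]mxE [delta_mx _ _ _ _]mxE.
case: (eqVneq i ord0) => [->|i0]; case: (eqVneq j ord0) => [->|j0] /=.
- by rewrite diag_lm00 mulr1.
- by rewrite diag_lm0r // mulr0.
- by rewrite diag_lm0l // mulr0.
rewrite mulr0 /diag_lm !mxE; case: splitP => k /= e; rewrite !mxE; last first.
  by case: splitP => k' _; rewrite mxE.
by case/negP: i0; apply/eqP/val_inj; rewrite /= e ord1.
Qed.

Lemma diag_lm_delta (i j : 'I_3) :
  diag_lm 0 (delta_mx i j : 'M[C]_3) = delta_mx (lift ord0 i) (lift ord0 j).
Proof.
apply/matrixP => a b; rewrite [RHS]mxE.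
case: (unliftP ord0 a) => [a'|] ->; case: (unliftP ord0 b) => [b'|] ->;
  rewrite ?diag_lm00 ?diag_lm0r ?diag_lm0l ?(eq_sym ord0) ?(negbTE (neq_lift _ _)) //=.
- rewrite !(inj_eq lift_inj) /diag_lm !mxE; case: splitP => k /= e.
    by have := ord1 k => k0; rewrite k0 in e.
  rewrite !mxE; case: splitP => l /= e'; first by have := ord1 l => l0; rewrite l0 in e'.
  have -> : k = a' by apply: val_inj; case: e.
  have -> : l = b' by apply: val_inj; case: e'.
  by rewrite mxE.
- by rewrite andbF.
Qed.

Lemma diag_lq_comb (l z w l' z' w' c : C) :
  diag_lq l z w + c *: diag_lq l' z' w' = mxl 4 4
  [:: [:: l + c * l'; 0; 0; 0]; [:: 0; conjc l + c * conjc l'; 0; 0];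
      [:: 0; 0; z + c * z'; w + c * w'];
      [:: 0; 0; - conjc w + c * - conjc w'; conjc z + c * conjc z']].
Proof.
rewrite !diag_lqE; apply/matrixP => i j; rewrite !mxE.
by case: (ord4P i) => ->; case: (ord4P j) => ->; rewrite /= ?mulr0 ?addr0.
Qed.

Lemma mxl_diag (l k z w z' w' : C) :
  mxl 4 4 [:: [:: l; 0; 0; 0]; [:: 0; k; 0; 0]; [:: 0; 0; z; w]; [:: 0; 0; z'; w']] =
  l *: delta_mx ord0 ord0 + k *: delta_mx o1 o1 + z *: delta_mx o2 o2 + w *: delta_mx o2 o3
  + z' *: delta_mx o3 o2 + w' *: delta_mx o3 o3.
Proof.
apply/matrixP => i j; rewrite !mxE.
by case: (ord4P i) => ->; case: (ord4P j) => ->; rewrite /= ?mulr0 ?mulr1 ?addr0 ?add0r.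
Qed.

Variables a23 a24 b23 b24 d21 d22 d23 d24 U : C.
Let D := Dirac 0 0 a23 a24 0 0 b23 b24 0 0 0 d21 d22 d23 d24 U.
Let D0' := D0 0 0 a23 a24 0 0 b23 b24 0 0 0 d21 d22 d23 d24.
Let X2 (c d : C) := Xmx (mxl 2 2 [:: [:: 0; 0]; [:: c; d]]).
Let Y := Ymx 0 0 0 d21 d22 d23 d24.
Let ev : 'M[C]_2 := delta_mx i1 i1.
Let ew : 'M[C]_2 := delta_mx i2 i2.

Lemma Cl_ext f g : Cl D f -> f =1 g -> Cl D g.
Proof. by move=> fD e; apply: sa_ext fD e. Qed.

Lemma Cl_sub f g : Cl D f -> Cl D g -> Cl D (fun u => f u - g u).
Proof.
move=> fD gD; apply: Cl_ext (sa_add fD (sa_scale (-1) gD)) _ => u.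
by rewrite /opadd scaleN1r.
Qed.

Lemma Cl_unscale (c : C) f : c != 0 -> Cl D (fun u => c *: f u) -> Cl D f.
Proof.
move=> c0 fD; apply: Cl_ext (sa_scale c^-1 fD) _ => u.
by rewrite scalerA mulVf // scale1r.
Qed.

(** The generators [a [D, b]] take [b] in the real algebra A only. The pair of memberships is stable
    under complex combinations, so it extends [D0, b] to [b] in the complex span of A. *)
Definition Clc f := Cl D f /\ Cl D (fun u => D0' (f u) - f (D0' u)).

Lemma Clc_ext f g : Clc f -> f =1 g -> Clc g.
Proof.
move=> [f1 f2] e; split; first exact: Cl_ext e.
by apply: Cl_ext f2 _ => u; rewrite !e.
Qed.

Let lD0 : is_linear D0'. Proof. exact: D0_linear. Qed.

Lemma Clc_add f g : Clc f -> Clc g -> Clc (opadd f g).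
Proof.
move=> [f1 f2] [g1 g2]; split; first exact: sa_add.
apply: Cl_ext (sa_add f2 g2) _ => u.
by rewrite /opadd (is_linearD _ _ lD0) opprD addrACA.
Qed.

Lemma Clc_scale (c : C) f : Clc f -> Clc (fun u => c *: f u).
Proof.
move=> [f1 f2]; split; first exact: sa_scale.
apply: Cl_ext (sa_scale c f2) _ => u.
by rewrite (is_linearZ _ _ lD0) scalerBr.
Qed.

Lemma tens1 u : tens 1%:M 1%:M 1%:M u = u.
Proof.
move: u; apply: op_ext => // [|p q]; first exact: tens_linear.
rewrite hcoord_tens hcoord_bvec !mxE -!natrM !mulnb pair3_eq.
by rewrite andbA.
Qed.

Lemma Aop1 u : Aop (1 : C) 1 0 1%:M u = u.
Proof.
rewrite /Aop /opadd.
have -> : diag_lq (1 : C) 1 0 = 1%:M.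
  rewrite diag_lqE !conjc0 !conjc1 oppr0; apply/matrixP => i j; rewrite !mxE.
  by case: (ord4P i) => ->; case: (ord4P j) => ->.
have -> : diag_lm (1 : C) 1%:M = 1%:M by rewrite /diag_lm -scalar_mx_block.
by rewrite -tensDm /e2 (@e2_sum1 R) tens1.
Qed.

Lemma Clc_inA f : inA f -> Clc f.
Proof.
move=> fA; split; first by apply: sa_gen; left.
(* The unit of A serves as [a], so that [D, f] itself is a generator. *)
have := sa_gen (G := Cl_gens D) (f := fun u => Aop (1 : C) 1 0 1%:M (D (f u) - f (D u))).
move=> H1; apply: Cl_ext (H1 _) _ => [|u].
  by right; exists (Aop (1 : C) 1 0 1%:M), f; split => //; exists 1, 1, 0, 1%:M.
by rewrite Aop1; apply: Dirac_commutator.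
Qed.

Lemma Clc_comb (l z w l' z' w' c : C) a a' :
  Clc (opadd (tens (diag_lq l z w + c *: diag_lq l' z' w') ev 1%:M)
             (tens (diag_lm l a + c *: diag_lm l' a') ew 1%:M)).
Proof.
have h1 : inA (Aop l z w a) by exists l, z, w, a.
have h2 : inA (Aop l' z' w' a') by exists l', z', w', a'.
apply: Clc_ext (Clc_add (Clc_inA h1) (Clc_scale c (Clc_inA h2))) _ => u.
by rewrite /opadd !tensD !tensZ /Aop /opadd scalerDr addrACA.
Qed.

Lemma Clc_unscale (c : C) f : c != 0 -> Clc (fun u => c *: f u) -> Clc f.
Proof.
move=> c0 fD; apply: Clc_ext (Clc_scale c^-1 fD) _ => u.
by rewrite scalerA mulVf // scale1r.
Qed.

Let two0 : (2%:R : C) != 0. Proof. by rewrite pnatr_eq0. Qed.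

Local Notation simpI := (conjc0, conjc1, conj_imI, mulr0, mulr1, mulrN, mul_imI, opprK, oppr0, addr0,
  add0r, subrr, scale0r, mulN1r, mulNr, addNr) (only parsing).

Lemma Clc_o1 : Clc (tens (delta_mx o1 o1) ev 1%:M).
Proof.
(* Adding i times the element with lambda = i to the one with lambda = 1 gives 1 + i i = 0 at lambda
   and 1 - i i = 2 at its conjugate. *)
apply: (Clc_unscale two0); apply: Clc_ext (Clc_comb 1 0 0 imI 0 0 imI 0 0) _ => u.
rewrite diag_lq_comb !diag_lm0 mxl_diag /opadd scalerA -scalerDl !simpI.
by rewrite tens0 addr0 tensZ.
Qed.

Lemma Clc_o0 : Clc (tens (delta_mx ord0 ord0) 1%:M 1%:M).
Proof.
(* The coefficient -i keeps lambda instead, and lambda occurs in both components: hence the middle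
   factor [1%:M]. *)
apply: (Clc_unscale two0); apply: Clc_ext (Clc_comb 1 0 0 imI 0 0 (- imI) 0 0) _ => u.
rewrite diag_lq_comb !diag_lm0 mxl_diag /opadd scalerA -scalerDl !simpI.
by rewrite !tensZ -scalerDr -tensDm (@e2_sum1 R).
Qed.

Lemma Clc_q (i j : 'I_4) : (1 < i)%N -> (1 < j)%N -> Clc (tens (delta_mx i j) ev 1%:M).
Proof.
move=> i1' j1'; apply: (Clc_unscale two0).
case: (ord4P i) i1' => -> // _; case: (ord4P j) j1' => -> // _.
(* The same device separates [z] from its conjugate and [w] from minus its conjugate, giving the
   four units of the quaternion block. *)
- apply: Clc_ext (Clc_comb 0 1 0 0 imI 0 (- imI) 0 0) _ => u.
  rewrite diag_lq_comb !diag_lm0 mxl_diag /opadd !simpI.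
  by rewrite scaler0 tens0 addr0 tensZ.
- apply: Clc_ext (Clc_comb 0 0 1 0 0 imI (- imI) 0 0) _ => u.
  rewrite diag_lq_comb !diag_lm0 mxl_diag /opadd !simpI.
  by rewrite scaler0 tens0 addr0 tensZ.
- apply: Clc_ext (Clc_comb 0 0 (-1) 0 0 imI (- imI) 0 0) _ => u.
  rewrite diag_lq_comb !diag_lm0 mxl_diag /opadd rmorphN rmorph1 !simpI.
  by rewrite scaler0 tens0 addr0 tensZ.
- apply: Clc_ext (Clc_comb 0 1 0 0 imI 0 imI 0 0) _ => u.
  rewrite diag_lq_comb !diag_lm0 mxl_diag /opadd !simpI.
  by rewrite scaler0 tens0 addr0 tensZ.
Qed.

Lemma Clc_m (i j : 'I_4) : i != ord0 -> j != ord0 -> Clc (tens (delta_mx i j) ew 1%:M).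
Proof.
case: (unliftP ord0 i) => [i'|] -> // _; case: (unliftP ord0 j) => [j'|] -> // _.
apply: Clc_ext (Clc_comb 0 0 0 0 0 0 0 (delta_mx i' j') 0) _ => u.
by rewrite diag_lq_comb diag_lm_delta mxl_diag /opadd !simpI tens0 add0r.
Qed.

Lemma Cl_tensM x m y x' m' y' : Cl D (tens x m y) -> Cl D (tens x' m' y') ->
  Cl D (tens (x *m x') (m *m m') (y *m y')).
Proof. by move=> f g; apply: Cl_ext (sa_mul f g) _ => u; rewrite tensM. Qed.

Lemma Cl_munitM p q r : Cl D (munit p q) -> Cl D (munit q r) -> Cl D (munit p r).
Proof. by move=> f g; have := Cl_tensM f g; rewrite !mul_delta_mx. Qed.

Lemma Cl_munit_sym p q : Cl D (munit p q) -> Cl D (munit q p).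
Proof. by move=> f; apply: sa_adj f (munit_adjoint q p). Qed.

(** With f g = 0 the product f [D0, g] loses its second term: corners of D0 lie in the algebra. *)
Lemma Clc_mul_D0 f g : is_linear f -> Clc f -> Clc g -> (forall u, f (g u) = 0) ->
  Cl D (fun u => f (D0' (g u))).
Proof.
move=> lf [fD _] [_ gD] fg0; apply: Cl_ext (sa_mul fD gD) _ => u.
by rewrite (is_linearB _ _ lf) fg0 subr0.
Qed.

(** The projection onto left label 2 in the v-component, where alpha, beta and [Y] have their only
    possibly non-zero rows. *)
Let p2 : op := tens (delta_mx o1 o1) ev 1%:M.

Lemma p2_tens k l (M : 'M[C]_4) (s t s' : 'I_2) y u :
  p2 (tens M (delta_mx s t) y (tens (delta_mx k l) (delta_mx s' s') 1%:M u)) =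
  ((i1 == s) && (t == s'))%:R *: (M o1 k *: tens (delta_mx o1 l) (delta_mx i1 s') y u).
Proof.
rewrite /p2 tensM tensM delta_mulmx_delta delta_mulmx_delta mul1mx mulmx1.
by rewrite tensZ tensZm scalerA mulrC -scalerA mxE (eq_sym t).
Qed.

Lemma p2_linear : is_linear p2. Proof. exact: tens_linear. Qed.

Lemma p2_D0_tens k l (s : 'I_2) u (c1 := ((i1 == i1) && (i1 == s))%:R : C)
    (c2 := ((i1 == i1) && (i2 == s))%:R : C) (c3 := ((i1 == i2) && (i1 == s))%:R : C) :
  p2 (D0' (tens (delta_mx k l) (delta_mx s s) 1%:M u)) =
  (c1 *: (X2 a23 a24 o1 k *: tens (delta_mx o1 l) (delta_mx i1 s) (e4_11 R) u) +
   c1 *: (X2 b23 b24 o1 k *: tens (delta_mx o1 l) (delta_mx i1 s) (1%:M - e4_11 R) u)) +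
  (c2 *: (Y o1 k *: tens (delta_mx o1 l) (delta_mx i1 s) (e4_11 R) u) +
   c3 *: (cmx Y o1 k *: tens (delta_mx o1 l) (delta_mx i1 s) (e4_11 R) u)).
Proof.
have lp := p2_linear.
apply: (etrans (is_linearD _ _ lp)); congr (_ + _); apply: (etrans (is_linearD _ _ lp));
  congr (_ + _); exact: p2_tens.
Qed.

Lemma p2_D0_v k l u : p2 (D0' (tens (delta_mx k l) ev 1%:M u)) =
  X2 a23 a24 o1 k *: munit (o1, i1, ord0) (l, i1, ord0) u
  + X2 b23 b24 o1 k *: lunit i1 o1 l u.
Proof. by rewrite p2_D0_tens !scale0r !scale1r addr0 addr0. Qed.

Lemma p2_D0_w k l u : p2 (D0' (tens (delta_mx k l) ew 1%:M u)) =
  Y o1 k *: munit (o1, i1, ord0) (l, i2, ord0) u.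
Proof. by rewrite p2_D0_tens !scale0r !scale1r !addr0 add0r. Qed.

Hypothesis d21N : d21 != 0.
Hypothesis aN : (a23 != 0) || (a24 != 0).
Hypothesis bN : (b23 != 0) || (b24 != 0).
Hypothesis dN : [|| d22 != 0, d23 != 0 | d24 != 0].

Let r0 : tens_idx := (o1, i1, ord0).

Lemma X2_o1 c d : (c != 0) || (d != 0) -> exists2 k : 'I_4, (1 < k)%N & X2 c d o1 k != 0.
Proof. by case/orP => h; [exists o2 | exists o3] => //; rewrite /X2 XmxE mxE. Qed.

Lemma X2_o1_0 c d : X2 c d o1 ord0 = 0.
Proof. by rewrite /X2 XmxE mxE. Qed.

(** The v-part of [e_11 (x) 1 (x) 1] contributes nothing, as column 1 of [X2] vanishes; delta_21 is
    the whole coefficient. *)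
Lemma Cl_r0_w0 : Cl D (munit r0 (ord0, i2, ord0)).
Proof.
apply: (Cl_unscale d21N).
have p20 u : p2 (tens (delta_mx ord0 ord0) 1%:M 1%:M u) = 0.
  by rewrite /p2; apply: tens_mul0; constructor 1; rewrite mul_delta_mx_cond.
apply: Cl_ext (Clc_mul_D0 p2_linear Clc_o1 Clc_o0 p20) _ => u.
have E : tens (delta_mx ord0 ord0) 1%:M 1%:M u =
    tens (delta_mx ord0 ord0) ev 1%:M u + tens (delta_mx ord0 ord0) ew 1%:M u.
  by rewrite -[RHS]tensDm (@e2_sum1 R).
apply: (etrans (congr1 (fun v => p2 (D0' v)) E)).
apply: (etrans (congr1 p2 (is_linearD _ _ lD0))); apply: (etrans (is_linearD _ _ p2_linear)).
apply: (etrans (congr2 +%R (p2_D0_v _ _ _) (p2_D0_w _ _ _))).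
rewrite !X2_o1_0 !scale0r addr0 add0r.
by congr (_ *: _); rewrite mxE.
Qed.

Lemma Cl_r0_r0 : Cl D (munit r0 r0).
Proof. exact: Cl_munitM Cl_r0_w0 (Cl_munit_sym Cl_r0_w0). Qed.

Lemma Cl_r0_w l : l != ord0 -> Cl D (munit r0 (l, i2, ord0)).
Proof.
move=> l0.
have [k k0 Yk] : exists2 k : 'I_4, k != ord0 & Y o1 k != 0.
  by case/or3P: dN => h; [exists o1 | exists o2 | exists o3] => //; rewrite mxE.
apply: (Cl_unscale Yk).
apply: Cl_ext (Clc_mul_D0 p2_linear Clc_o1 (Clc_m k0 l0) _) _ => u; last exact: p2_D0_w.
by rewrite /p2; apply: tens_mul0; constructor 2; apply: e2_mul0.
Qed.

Lemma Cl_X2_row (k l : 'I_4) : (1 < k)%N -> (1 < l)%N ->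
  Cl D (fun u => X2 a23 a24 o1 k *: munit r0 (l, i1, ord0) u
    + X2 b23 b24 o1 k *: lunit i1 o1 l u).
Proof.
move=> k1 l1.
apply: Cl_ext (Clc_mul_D0 p2_linear Clc_o1 (Clc_q k1 l1) _) _ => u; last exact: p2_D0_v.
rewrite /p2; apply: tens_mul0; constructor 1; rewrite mul_delta_mx_cond.
by case: eqP k1 => // <-.
Qed.

Lemma Cl_r0_v (l : 'I_4) : (1 < l)%N -> Cl D (munit r0 (l, i1, ord0)).
Proof.
move=> l1; have [k k1 Xk] := X2_o1 aN; apply: (Cl_unscale Xk).
(* The alpha and beta terms come mixed. The unit at [r0], obtained from delta_21, has third factor
   [e_11] and kills the beta term. *)
apply: Cl_ext (sa_mul Cl_r0_r0 (Cl_X2_row k1 l1)) _ => u.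
have lr : is_linear (munit r0 r0 : op) := tens_linear _ _ _.
rewrite (is_linearD _ _ lr) (is_linearZ _ _ lr) (is_linearZ _ _ lr).
rewrite [in X in _ + X]/munit [in X in _ + X]/lunit tens_mul0 ?scaler0 ?addr0; last first.
  constructor 3; rewrite mulmxBr mulmx1 mul_delta_mx subrr //.
by rewrite [in LHS]/munit tensM !mul_delta_mx.
Qed.

(** [r0] is joined to every label of [K1], so each unit factors through it. *)
Lemma Cl_munit p q : K1 p -> K1 q -> Cl D (munit p q).
Proof.
have Cr0 r : K1 r -> Cl D (munit r0 r).
  case: r => [[i s] j]; rewrite /K1 => /andP[/= /eqP ->].
  case: (ord2P s) => -> /=; last first.
    by move=> _; case: (eqVneq i ord0) => [->|]; [apply: Cl_r0_w0 | apply: Cl_r0_w].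
  by case: (ord4P i) => -> // _; [apply: Cl_r0_r0 | apply: Cl_r0_v | apply: Cl_r0_v].
by move=> Kp Kq; apply: Cl_munitM (Cl_munit_sym (Cr0 p Kp)) (Cr0 q Kq).
Qed.

Lemma Cl_lunit s i k : i != ord0 -> k != ord0 -> Cl D (lunit s i k).
Proof.
have lM s' i' k' l' : Cl D (lunit s' i' k') -> Cl D (lunit s' k' l') -> Cl D (lunit s' i' l').
  by move=> f g; have := Cl_tensM f g; rewrite !mul_delta_mx sub_e00_id.
have lS s' i' k' : Cl D (lunit s' i' k') -> Cl D (lunit s' k' i').
  by move=> f; apply: sa_adj f (lunit_adjoint s' k' i').
case: (ord2P s) => -> i0 k0; last first.
  (* On w the summand M_3 of A supplies [e_ik] for every right index; subtracting the unit at right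
     index 1 leaves the block. *)
  apply: Cl_ext (Cl_sub (proj1 (Clc_m i0 k0)) (@Cl_munit (i, i2, ord0) (k, i2, ord0) _ _)) _ => //.
  by move=> u; apply/esym/tensBy.
have C1 (l : 'I_4) : (1 < l)%N -> Cl D (lunit i1 o1 l).
  move=> l1; have [c c1 Xc] := X2_o1 bN; apply: (Cl_unscale Xc).
  (* The alpha part is already in the algebra, so the beta part can be isolated. *)
  apply: Cl_ext (Cl_sub (Cl_X2_row c1 l1) (sa_scale (X2 a23 a24 o1 c) (Cl_r0_v l1))) _ => u.
  by rewrite [LHS]addrAC subrr add0r.
have C2 l : l != ord0 -> Cl D (lunit i1 o1 l).
  case: (ord4P l) => -> // _; [|exact: C1|exact: C1].
  (* beta has no diagonal entry: in labels, e_22 is obtained as e_23 e_32. *)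
  by apply: lM (C1 o2 _) (lS _ _ _ (C1 o2 _)).
by apply: lM (lS _ _ _ (C2 i i0)) (C2 k k0).
Qed.

Lemma commutant_sub_opposite f : is_linear f ->
  (forall g, Cl D g -> forall u, f (g u) = g (f u)) -> Cl D (fun u => J (f (J u))).
Proof.
move=> lf fD.
pose P (h : op) := Cl D (fun u => J (h (J u))); suff : P f by [].
apply: comm_K1_lunit_span
  => [//|p q Kp Kq u|s i k i0 k0 u|h k hP e|h k hP kP|c h hP||p q Kp Kq|s j l j0 l0].
- exact: fD (Cl_munit Kp Kq) u.
- exact: fD (Cl_lunit s i0 k0) u.
- by apply: Cl_ext hP _ => u; rewrite e.
- by apply: Cl_ext (sa_add hP kP) _ => u; rewrite /opadd JD.
- by apply: Cl_ext (sa_scale (conjc c) hP) _ => u; rewrite JZ.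
(* J carries [projK1] to [e_11 (x) 1 (x) 1] minus the unit at (1, w, 1), that is, to the projection
   onto [K2]. *)
- apply: Cl_ext (Cl_sub (proj1 Clc_o0) (@Cl_munit (ord0, i2, ord0) (ord0, i2, ord0) _ _)) _ => // u.
  have e1 : J (tens 1%:M 1%:M (e4_11 R) (J u)) = tens (e4_11 R) 1%:M 1%:M u.
    by rewrite conjJ_tens conj_e00 conj1 mflip1.
  rewrite /projK1 /opadd JD JZ rmorphN1 munit_J scaleN1r e1.
  by [].
- apply: Cl_ext (@Cl_munit (swap_idx p) (swap_idx q) _ _) _ => [||u].
  + by rewrite K_swap.
  + by rewrite K_swap.
  + by rewrite munit_J.
- by apply: Cl_ext (Cl_lunit (oppi s) j0 l0) _ => u; rewrite runit_J.
Qed.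
End Membership.

(** * Each condition is forced by the Hodge property *)

Section Necessity.
Variable R : realType.
Local Notation C := R[i].
Local Notation H := (H R).
Local Notation op := (op R).
Implicit Types (f g : op) (u v : H) (x y : 'M[C]_4) (m : 'M[C]_2).

(** Idempotent first factors with an entry 1 let commutation descend to one entry of the third
    factor, where the contradictions below are read off. *)
Lemma tens_comm_entry x m y y' i s k l : x *m x = x -> m *m m = m ->
  x i i = 1 -> m s s = 1 ->
  (forall u, tens x m y (tens x m y' u) = tens x m y' (tens x m y u)) ->
  (y *m y') k l = (y' *m y) k l.
Proof.
move=> xx mm xi ms e; have := congr1 (hcoord (i, s, k)) (e (bvec R (i, s, l))).
by rewrite 2!tensM !hcoord_tens xx mm xi ms !mul1r.
Qed.

(** The unit of the quaternion block, central among the [diag_lq]. If alpha or beta vanishes, this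
    block splits from label 2 at right index 1, respectively at the others. *)
Definition P23 : 'M[C]_4 := delta_mx o2 o2 + delta_mx o3 o3.

Lemma P23E : P23 = 1%:M - e4_11 R - delta_mx o1 o1.
Proof.
apply/matrixP => i j; rewrite !mxE.
by case: (ord4P i) => ->; case: (ord4P j) => ->; rewrite /= ?subr0 ?subrr ?addr0 ?add0r.
Qed.

Lemma diag_lq_comm_P23 (l z w : C) : diag_lq l z w *m P23 = P23 *m diag_lq l z w.
Proof.
rewrite P23E mulmxBr mulmxBl diag_lq_comm_1e00; congr (_ - _).
by rewrite mulmx_delta_diag ?delta_mulmx_diag // => i i0;
  rewrite diag_lqE mxE; case: (ord4P i) i0 => ->.
Qed.

Lemma conj_P23 : map_mx (@conjc R) P23 = P23.
Proof. by rewrite map_mxD !conj_delta. Qed.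

Lemma cmx_P23 : cmx P23 = P23.
Proof. by rewrite /cmx conj_P23 raddfD /= !trmx_delta. Qed.

Lemma o12_P23 : (delta_mx o1 o2 : 'M[C]_4) *m P23 = delta_mx o1 o2.
Proof. by rewrite mulmxDr !mul_delta_mx_cond addr0. Qed.

Lemma P23_o12 : P23 *m (delta_mx o1 o2 : 'M[C]_4) = 0.
Proof. by rewrite mulmxDl !mul_delta_mx_cond addr0. Qed.

Lemma e00_sub : (e4_11 R *m (1%:M - e4_11 R) = 0) * ((1%:M - e4_11 R) *m e4_11 R = 0).
Proof. by rewrite mulmxBl mulmxBr mul1mx mulmx1 e00_id subrr. Qed.

Variables a23 a24 b23 b24 d21 d22 d23 d24 U : C.
Let D := Dirac 0 0 a23 a24 0 0 b23 b24 0 0 0 d21 d22 d23 d24 U.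
Let D0' := D0 0 0 a23 a24 0 0 b23 b24 0 0 0 d21 d22 d23 d24.
Let Y := Ymx 0 0 0 d21 d22 d23 d24.

Hypothesis HD : Hodge (Cl D).

Lemma Hodge_tens x (s : 'I_2) y : cmx x = x -> cmx y = y ->
  (forall f, inA f -> forall u, tens x (e2 R s s) y (f u) = f (tens x (e2 R s s) y u)) ->
  (forall u, tens x (e2 R s s) y (D0' u) = D0' (tens x (e2 R s s) y u)) ->
  Cl D (tens (map_mx (@conjc R) y) (e2 R (oppi s) (oppi s)) (map_mx (@conjc R) x)).
Proof.
move=> cx cy cA cD.
have aj := tens_adjoint x (e2 R s s) y; rewrite cx cy cmx_delta in aj.
have cz : commutant (Cl D) (tens x (e2 R s s) y).
  split; first exact: tens_linear.
  by move=> g gD u; apply: Cl_comm aj _ _ _ _ _ gD u.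
have [xi [eta [xiD [a e]]]] := (HD _).1 cz.
apply: Cl_ext (sa_adj xiD a) _ => u.
have -> : eta u = J (tens x (e2 R s s) y (J u)) by rewrite e !JK.
by rewrite conjJ_tens mflip_delta.
Qed.

Lemma X2_0 : Xmx (mxl 2 2 [:: [:: 0; 0]; [:: 0; 0]]) = 0 :> 'M[C]_4.
Proof.
rewrite XmxE !conjc0; apply/matrixP => i j; rewrite !mxE.
by case: (ord4P i) => ->; case: (ord4P j) => ->.
Qed.

Lemma Y_col j l : Y o1 j = 0 ->
  (Y *m delta_mx j l = 0 :> 'M[C]_4) * (delta_mx l j *m cmx Y = 0 :> 'M[C]_4).
Proof.
move=> Yj; have Y0 k : Y k j = 0.
  by case: (eqVneq k o1) => [->|] //; apply: Y_row.
by split; [apply: mulmx_delta0 | apply: delta_mulmx0 => k; rewrite 2!mxE Y0 conjc0].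
Qed.

(** Without delta_21 the projection onto (1, w, 1) commutes with D0. Its conjugate projects onto (1,
    v, 1) and fails to commute with the unit from (1, v, 2) to (1, v, 1), both labels of [K2]. *)
Lemma Hodge_d21 : d21 <> 0.
Proof.
move=> d0; have Y0 : Y o1 ord0 = 0 by rewrite mxE.
have : Cl D (tens (map_mx (@conjc R) (e4_11 R)) (e2 R i1 i1) (map_mx (@conjc R) (e4_11 R))).
  apply: (@Hodge_tens _ i2); [exact: cmx_e00 | exact: cmx_e00 | |].
    by move=> f fA u; rewrite inA_comm_e00.
  apply: comm_D0 => [|u|u|u|u]; first exact: tens_linear.
  - by apply: tens_comm0; constructor 2; apply: e2_mul0.
  - by apply: tens_comm0; constructor 2; apply: e2_mul0.
  - apply: tens_comm0; first by constructor 2; apply: e2_mul0.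
    by constructor 1; apply: (Y_col _ Y0).1.
  - apply: tens_comm0; last by constructor 2; apply: e2_mul0.
    by constructor 1; apply: (Y_col _ Y0).2.
rewrite conj_e00 => gD.
have cm u := @munit_Cl R _ _ _ _ _ _ _ _ _ (ord0, i1, ord0) (ord0, i1, o1) _ u isT isT gD.
have := @tens_comm_entry _ _ _ _ ord0 i1 ord0 o1 (e00_id R) (mul_delta_mx _ _ _) _ _ cm.
rewrite delta_e00 // mul_delta_mx !mxE /= => /(_ erefl erefl) /esym/eqP.
by rewrite oner_eq0.
Qed.

(** The projection onto (3, v, 1) and (4, v, 1) is used; its conjugate separates (1, w, 3) from (1,
    w, 2) inside [K2]. *)
Lemma Hodge_alpha : (a23, a24) <> (0, 0).
Proof.
case=> a0 a0'.
have : Cl D (tens (map_mx (@conjc R) (e4_11 R)) (e2 R i2 i2) (map_mx (@conjc R) P23)).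
  apply: (@Hodge_tens _ i1); [exact: cmx_P23 | exact: cmx_e00 | |].
    by move=> f fA u; apply/esym; apply: inA_comm_i1 fA; apply: diag_lq_comm_P23.
  apply: comm_D0 => [|u|u|u|u]; first exact: tens_linear.
  - by apply: tens_comm0; constructor 1; rewrite a0 a0' X2_0 (mulmx0, mul0mx).
  - by apply: tens_comm0; constructor 3; rewrite e00_sub.
  - apply: tens_comm0; last by constructor 2; apply: e2_mul0.
    by constructor 1; rewrite mulmxDl !Y_delta // addr0.
  - apply: tens_comm0; first by constructor 2; apply: e2_mul0.
    by constructor 1; rewrite mulmxDr !Y_delta // addr0.
rewrite conj_e00 conj_P23 => gD.
have cm u := @munit_Cl R _ _ _ _ _ _ _ _ _ (ord0, i2, o1) (ord0, i2, o2) _ u isT isT gD.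
have := @tens_comm_entry _ _ _ _ ord0 i2 o1 o2 (e00_id R) (mul_delta_mx _ _ _) _ _ cm.
rewrite o12_P23 P23_o12 !mxE /= => /(_ erefl erefl) /eqP.
by rewrite oner_eq0.
Qed.

(** Here [Y] has only its first column left, so the projection onto the labels (l, w, 1) with l > 1
    commutes with D0; its conjugate separates (1, v, 2) from (1, v, 1). *)
Lemma Hodge_delta : (d22, d23, d24) <> (0, 0, 0).
Proof.
case=> d20 d30 d40.
have Y0 k : k != ord0 -> Y o1 k = 0 by rewrite mxE; case: (ord4P k) => ->.
have Yz : Y *m (1%:M - e4_11 R) = 0.
  apply/matrixP => i j; rewrite mxE big1 ?mxE // => k _; rewrite one_sub_e4_11.
  case: (eqVneq i o1) => [->|i1']; last by rewrite Y_row // mul0r.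
  by case: (eqVneq k ord0) => [_|k0]; rewrite ?andbF ?mulr0 // Y0 // mul0r.
have Yz' : (1%:M - e4_11 R) *m cmx Y = 0.
  by rewrite -cmx_1e00 /cmx -trmx_mul -map_mxM Yz map_mx0 trmx0.
have : Cl D (tens (map_mx (@conjc R) (e4_11 R)) (e2 R i1 i1)
    (map_mx (@conjc R) (1%:M - e4_11 R))).
  apply: (@Hodge_tens _ i2); [exact: cmx_1e00 | exact: cmx_e00 | |].
    by move=> f fA u; apply/esym; apply: inA_comm_i2 fA; apply: diag_lm_comm_1e00.
  apply: comm_D0 => [|u|u|u|u]; first exact: tens_linear.
  - by apply: tens_comm0; constructor 2; apply: e2_mul0.
  - by apply: tens_comm0; constructor 2; apply: e2_mul0.
  - by apply: tens_comm0; [constructor 2; apply: e2_mul0 | constructor 1].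
  - by apply: tens_comm0; [constructor 1 | constructor 2; apply: e2_mul0].
rewrite conj_e00 conj_1e00 => gD.
have cm u := @munit_Cl R _ _ _ _ _ _ _ _ _ (ord0, i1, ord0) (ord0, i1, o1) _ u isT isT gD.
have := @tens_comm_entry _ _ _ _ ord0 i1 ord0 o1 (e00_id R) (mul_delta_mx _ _ _) _ _ cm.
rewrite mulmxBr mulmxBl mulmx1 mul1mx delta_e00 // subr0 mul_delta_mx subrr !mxE /=.
by move=> /(_ erefl erefl) /eqP; rewrite oner_eq0.
Qed.

(** The obstruction now lives in the blocks: the conjugate projection is
    [(1 - e_11) (x) e_22 (x) P23], tested against a [runit] rather than a unit on [K2]. *)
Lemma Hodge_beta : (b23, b24) <> (0, 0).
Proof.
case=> b0 b0'.
have : Cl D (tens (map_mx (@conjc R) (1%:M - e4_11 R)) (e2 R i2 i2) (map_mx (@conjc R) P23)).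
  apply: (@Hodge_tens _ i1); [exact: cmx_P23 | exact: cmx_1e00 | |].
    by move=> f fA u; apply/esym; apply: inA_comm_i1 fA; apply: diag_lq_comm_P23.
  apply: comm_D0 => [|u|u|u|u]; first exact: tens_linear.
  - by apply: tens_comm0; constructor 3; rewrite e00_sub.
  - by apply: tens_comm0; constructor 1; rewrite b0 b0' X2_0 (mulmx0, mul0mx).
  - by apply: tens_comm0; constructor 3; rewrite e00_sub.
  - by apply: tens_comm0; constructor 3; rewrite e00_sub.
rewrite conj_1e00 conj_P23 => gD.
have cm u := @runit_Cl R _ _ _ _ _ _ _ _ _ i2 o1 o2 _ u isT isT gD.
have := @tens_comm_entry _ _ _ _ o1 i2 o1 o2 (sub_e00_id R) (mul_delta_mx _ _ _) _ _ cm.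
rewrite o12_P23 P23_o12 !mxE /= subr0 => /(_ erefl erefl) /eqP.
by rewrite oner_eq0.
Qed.
End Necessity.

Theorem theorem19 (R : realType)
    (a13 a14 a23 a24 b13 b14 b23 b24 d12 d13 d14 d21 d22 d23 d24 U : R[i]) :
  d12 = 0 -> d13 = 0 -> d14 = 0 -> b13 = 0 -> b14 = 0 -> a13 = 0 -> a14 = 0 ->
  (Hodge (Cl (Dirac a13 a14 a23 a24 b13 b14 b23 b24
                    d12 d13 d14 d21 d22 d23 d24 U))
   <-> (d21 <> 0 /\ (a23, a24) <> (0, 0) /\ (b23, b24) <> (0, 0)
        /\ (d22, d23, d24) <> (0, 0, 0))).
Proof.
do 7!move=> ->; split=> [HD|[/eqP d21N [/eqP aN [/eqP bN /eqP dN]]] xi].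
  split; first exact: Hodge_d21 HD.
  split; first exact: Hodge_alpha HD.
  by split; [exact: Hodge_beta HD | exact: Hodge_delta HD].
have {}aN : (a23 != 0) || (a24 != 0) by rewrite -negb_and.
have {}bN : (b23 != 0) || (b24 != 0) by rewrite -negb_and.
have {}dN : [|| d22 != 0, d23 != 0 | d24 != 0] by rewrite orbA -!negb_and.
split=> [[lxi cxi]|[f [g [fD [ag e]]]]].
  have gD := commutant_sub_opposite d21N aN bN dN lxi cxi.
  (* The opposite is formed through adjoints, so the witness in the algebra is the adjoint of the
     conjugate of [xi] by J. *)
  have [f af] := adjoint_exists (Cl_linear gD).
  exists f, (fun u => J (xi (J u))); split; first exact: sa_adj gD (is_adjoint_sym af).
  by split=> // u; rewrite !JK.
have gD := sa_adj fD ag.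
split=> [c u v|h hD u]; first by rewrite !e; apply: conjJ_linear (Cl_linear gD) _ _ _.
by rewrite !e; apply: opposite_sub_commutant gD _ hD u.
Qed.
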